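(* There exist universal constants $0<c_1\le C_1<\infty$ such that the following holds. Let $G$ and $H$ be finite connected graphs, with $G$ regular. Let $P$ be the transition matrix of the lazy simple random walk on $G$, and let $Q$ be the transition matrix of an ergodic (irreducible and aperiodic) reversible Markov chain on $V(H)$. Let $X^\diamond$ be the generalized lamplighter chain on $H\wr G$ associated with $P$ and $Q$. Then $$c_1\;\le\;\frac{t_{\mathrm{rel}}(H\wr G)}{t_{\mathrm{hit}}(G)+|G|\,t_{\mathrm{rel}}(H)}\;\le\; C_1 .$$ Here $t_{\mathrm{rel}}(H\wr G)$ is the relaxation time of $X^\diamond$, $t_{\mathrm{rel}}(H)$ is the relaxation time of $Q$, $t_{\mathrm{hit}}(G)$ is the maximal expected hitting time of $P$, and $|G|=|V(G)|$.
   Context: Lazy random walk on $G$: $P(x,x)=\tfrac12$, $P(x,y)=\tfrac{1}{2d(x)}$ if $\{x,y\}\in E(G)$, and $P(x,y)=0$ otherwise, where $d(x)$ is the degree of $x$. Generalized lamplighter chain $X^\diamond$: its state space is the set of pairs $(\underline f,x)$ with $\underline f=(f_v)_{v\in V(G)}$, $f_v\in V(H)$, and $x\in V(G)$ (the vertex set of the wreath product $H\wr G$). From $(\underline f,x)$, the chain first picks $y$ with probability $P(x,y)$ and moves the walker to $y$; it then updates each of $f_x$ and $f_y$ independently by one step of $Q$ (if $y=x$, the lamp $f_x$ is updated by two successive independent steps of $Q$). All $f_z$ with $z\notin\{x,y\}$ are unchanged. This chain is reversible, with stationary distribution $\pi^\diamond(\underline f,x)=\pi_G(x)\prod_{v\in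 V(G)}\pi_H(f_v)$, where $\pi_G,\pi_H$ are the stationary distributions of $P$ and $Q$. Relaxation time of a reversible Markov chain: $t_{\mathrm{rel}}=\frac{1}{1-\lambda_2}$, where $\lambda_2$ is the second largest eigenvalue of its transition matrix. Maximal hitting time: $t_{\mathrm{hit}}(G)=\max_{x,y\in V(G)}\mathbf E_x[\tau_y]$, where $\tau_y$ is the first time $t$ that the walk with transition matrix $P$ is at $y$, and $\mathbf E_x$ is expectation for the walk started at $x$.
   Formalization: In the relaxation time, λ_2 is the second largest eigenvalue in absolute value, t_rel = 1/(1-|λ_2|); with the signed order the claim fails (G = K_2, Q on two states with eigenvalue near -1). G and H are assumed to have at least two vertices each. *)

(* Defs.v *)
From HB Require Import structures.
From mathcomp Require Import all_boot all_order all_algebra.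
From mathcomp Require Import all_classical all_reals all_analysis.
From mathcomp Require Import polyrcf.

Set Implicit Arguments.
Unset Strict Implicit.
Unset Printing Implicit Defensive.

Import Order.TTheory GRing.Theory Num.Theory.

Local Open Scope ring_scope.

(* A finite simple graph is a symmetric irreflexive adjacency relation. *)
Definition simple_graph (V : finType) (e : rel V) : Prop :=
  symmetric e /\ irreflexive e.

Definition connected_graph (V : finType) (e : rel V) : Prop :=
  forall x y : V, connect e x y.

Definition degree (V : finType) (e : rel V) (x : V) : nat :=
  #|[set y | e x y]|.

Definition regular_graph (V : finType) (e : rel V) : Prop :=
  exists d : nat, forall x : V, degree e x = d.

(* Transition kernels on a finite type are plain functions T -> T -> R. *)
Section Chains.
Variables (R : realType) (T : finType).
Implicit Type p : T -> T -> R.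

Definition stochastic p : Prop :=
  (forall x y, 0 <= p x y) /\ (forall x, \sum_(y : T) p x y = 1).

Fixpoint kpow p (t : nat) (x y : T) : R :=
  if t is t'.+1 then \sum_(z : T) p x z * kpow p t' z y else (x == y)%:R.

Definition irreducible_chain p : Prop :=
  forall x y, exists t : nat, 0 < kpow p t x y.

(* At every state the gcd of the possible return times is 1. *)
Definition aperiodic_chain p : Prop :=
  forall (x : T) (d : nat),
    (forall t : nat, (0 < t)%N -> 0 < kpow p t x x -> (d %| t)%N) -> d = 1%N.

Definition reversible_chain p : Prop :=
  exists pi : T -> R,
    [/\ forall x, 0 <= pi x, \sum_(x : T) pi x = 1 &
        forall x y, pi x * p x y = pi y * p y x].

Definition transition_matrix p : 'M[R]_#|T| :=
  \matrix_(i, j) p (enum_val i) (enum_val j).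

(* The real eigenvalues, repeated according to their algebraic multiplicity;
   for a reversible chain these are all the eigenvalues. *)
Definition eigenvalues p : seq R :=
  let chi := char_poly (transition_matrix p) in
  flatten [seq nseq (mup a chi) a | a <- rootsR chi].

(* "Second largest" refers to the absolute value, so that [trel] is the inverse
   of the absolute spectral gap. With the order of the real line the comparison
   of [trel] of the lamplighter chain with [thit] and [trel] of the lamp chain
   fails when the lamp chain has an eigenvalue close to -1: on two vertices,
   with lamps in {0,1} flipped with probability 1 - eps, the lamplighter chain
   has an eigenvalue tending to 1 as eps tends to 0. *)
Definition lambda2 p : R :=
  (sort (fun a b : R => `|b| <= `|a|) (eigenvalues p))`_1.

(* In \bar R, 0^-1 = +oo, hence [trel p = +oo] if there is no spectral gap. *)
Definition trel p : \bar R := ((1 - `|lambda2 p|)%:E^-1)%E.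

(* Probability, for the chain started at x, that the first t >= 0 at which the
   chain is at y equals t; the sum is over the trajectories of length t. *)
Definition hit_at p (x y : T) (t : nat) : R :=
  \sum_(w : {ffun 'I_t.+1 -> T} |
        [&& w ord0 == x, w ord_max == y &
            [forall i : 'I_t.+1, (i < t)%N ==> (w i != y)]])
    \prod_(i < t) p (w (inord i)) (w (inord i.+1)).

(* The hitting time is almost surely finite for an irreducible chain, so that
   its expectation has no term for the value +oo. *)
Definition expected_hit p (x y : T) : \bar R :=
  (\sum_(0 <= t <oo) (t%:R * hit_at p x y t)%:E)%E.

Definition thit p : \bar R :=
  \big[maxe/0%E]_(xy : T * T) expected_hit p xy.1 xy.2.

End Chains.

Definition lazy_walk (R : realType) (V : finType) (e : rel V) (x y : V) : R :=
  if y == x then 2^-1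
  else if e x y then (2 * (degree e x)%:R)^-1 else 0.

Definition lamplighter (R : realType) (V W : finType)
    (P : V -> V -> R) (Q : W -> W -> R) (s s' : {ffun V -> W} * V) : R :=
  let: (f, x) := s in
  let: (g, y) := s' in
  P x y *
  (if y == x then kpow Q 2 (f x) (g x)
   else Q (f x) (g x) * Q (f y) (g y)) *
  [forall z, (z != x) && (z != y) ==> (g z == f z)]%:R.

(* Main.v *)
Require Import Defs.
From mathcomp Require Import all_boot all_order all_algebra.
From mathcomp Require Import all_classical all_reals all_analysis.
From mathcomp Require Import polyrcf complex.
From mathcomp Require Import ring lra.
Import Order.TTheory GRing.Theory Num.Theory.
Local Open Scope ring_scope.

(** The lamplighter operator acts on [F (f, x)] by
    [T F (f, x) = \sum_y P x y (A_x A_y F_y) f], where [A_v] updates the lamp at [v]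
    with [Q]. Hence [<F, T F> = <F~, P F~>] with [F~_x = A_x F_x], which is nonnegative
    because [P] is lazy, and equals [|F~|^2] minus the Dirichlet form of [F~].

    Upper bound. Let [F] be an eigenfunction for [a]. If its resampled average at some
    site [v] is not [F], subtract it: the difference is an eigenfunction whose lamp
    averages at [v] vanish, so [|F~_v|] is controlled by the gap of [Q], and
    [|F~ - F~_v|^2 <= thit * (Dirichlet form)] because a function vanishing at [v] can be
    compared with the hitting time [w_v (x) = E_x tau_v]. Otherwise [F] depends on the
    walker only and is an eigenfunction of [P].

    Lower bound. Take [F (f, x) = phi (f v) u x] with [phi] a second eigenfunction
    of [Q]. The choice [u = w_v] gives [trel >= E_pi tau_v], and [thit] is at most
    4 times the largest of these means; the choice [u = 1] off [v] and [u = 1] or [-1]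
    at [v] gives [2 * trel >= |G| * trel Q]. *)

(** * Spectrum of a reversible chain *)

(* The real and imaginary parts [a], [b] of a unitary diagonalisation. *)
Lemma symmetric_mx_spectrum (R : rcfType) (n : nat) (S : 'M[R]_n) :
  S^T = S ->
  exists (d : 'rV[R]_n) (a b : 'M[R]_n),
    [/\ a *m S = diag_mx d *m a, b *m S = diag_mx d *m b,
        a^T *m a + b^T *m b = 1%:M,
        a *m a^T + b *m b^T = 1%:M /\ b *m a^T = a *m b^T &
        char_poly S = \prod_(i < n) ('X - (d 0 i)%:P)].
Proof.
move=> symS; pose toC := real_complex R; pose A := map_mx toC S.
have realM m p (M : 'M[R]_(m, p)) : map_mx toC M \is a realmx.
  by apply/mxOverP => i j; rewrite mxE; apply/complex_realP; eexists.
have hA : A \is hermsymmx.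
  apply: realsym_hermsym; last exact: realM.
  by apply/is_hermitianmxP; rewrite expr0 scale1r map_mx_id// /A map_trmx symS.
have /orthomx_spectralP := hermitian_normalmx hA.
have := hermitian_spectral_diag_real hA.
have := spectral_unitarymx A.
set P := spectralmx A; set sp := spectral_diag A => uP rsp eqA.
pose a := map_mx (@complex.Re R) P; pose b := map_mx (@complex.Im R) P.
pose d := map_mx (@complex.Re R) sp.
have Pab : P = map_mx toC a + 'i%C *: map_mx toC b.
  by apply/matrixP=> i j; rewrite !mxE /toC -complexE.
have spd : sp = map_mx toC d.
  by apply/matrixP=> i j; rewrite !mxE /toC RRe_real// (mxOverP rsp).
have PA : P *m A = diag_mx sp *m P.
  by rewrite eqA !mulmxA mulmxV ?mul1mx// unitarymx_unit.
(* A complex matrix identity splits into its real and imaginary parts; the real matrix identities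
   below all come from this. *)
have inj m p (M N M' N' : 'M[R]_(m, p)) :
    map_mx toC M + 'i%C *: map_mx toC N = map_mx toC M' + 'i%C *: map_mx toC N' ->
    M = M' /\ N = N'.
  move=> /matrixP e; split; apply/matrixP => i j; move: (e i j);
    by rewrite !mxE /toC => /(congr1 (fun z => (complex.Re z, complex.Im z))) /=;
      rewrite !(mul0r, mul1r, mulr0, addr0, add0r, subr0, oppr0) => -[].
have Pc : map_mx Num.conj P^T = map_mx toC a^T - 'i%C *: map_mx toC b^T.
  by apply/matrixP=> i j; rewrite !mxE /toC; case: (P j i) => u v /=; simpc.
have PtP : map_mx Num.conj P^T *m P = 1%:M.
  by move: (uP); rewrite -trmxC_unitary => /unitarymxP; rewrite trmxCK.
have PPt : P *m map_mx Num.conj P^T = 1%:M by apply/unitarymxP.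
have sqi : 'i%C * 'i%C = -1 :> R[i] by rewrite -expr2 sqr_i.
exists d, a, b.
have [e1 e2] : a *m S = diag_mx d *m a /\ b *m S = diag_mx d *m b.
  apply: inj; rewrite !map_mxM !map_diag_mx -spd.
  by move: PA; rewrite [in LHS]Pab [in RHS]Pab mulmxDl mulmxDr -scalemxAl -scalemxAr.
have [f1 _] : a^T *m a + b^T *m b = 1%:M /\ a^T *m b - b^T *m a = 0.
  apply: inj; rewrite !map_mxB !map_mxD !map_mxM map_mx1 map_mx0 scaler0 addr0 -PtP.
  rewrite Pc [in RHS]Pab !(mulmxDl, mulmxDr, mulNmx) -!(scalemxAl, scalemxAr).
  rewrite scalerA sqi scaleN1r opprK scalerBr addrACA; congr (_ + _).
  exact: addrC.
have [g1 g2] : a *m a^T + b *m b^T = 1%:M /\ b *m a^T - a *m b^T = 0.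
  apply: inj; rewrite !map_mxB !map_mxD !map_mxM map_mx1 map_mx0 scaler0 addr0 -PPt.
  rewrite Pc [in RHS]Pab !(mulmxDl, mulmxDr, mulmxN) -!(scalemxAl, scalemxAr).
  rewrite scalerA sqi scaleN1r opprK scalerBr [_ - _]addrC addrACA; congr (_ + _).
  exact: addrC.
split => //; first by split => //; apply/eqP; rewrite -subr_eq0 g2.
apply: (@map_poly_inj _ _ toC).
rewrite (map_char_poly toC) -/A rmorph_prod/=.
transitivity (char_poly (diag_mx sp)).
  (* Similar matrices share their characteristic polynomial: both sides are multiplied by the
     nonzero determinant of [P], which is then cancelled. *)
  have dP : \det (map_mx polyC P) != 0.
    by rewrite det_map_mx polyC_eq0 -unitfE -unitmxE unitarymx_unit.
  apply: (mulfI dP); rewrite /char_poly [RHS]mulrC -!det_mulmx /char_poly_mx.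
  by rewrite mulmxBl mulmxBr scalar_mxC -!map_mxM PA.
rewrite char_poly_trig ?diag_mx_is_trig//.
apply: eq_bigr => i _; rewrite rmorphB/= map_polyX map_polyC/= mxE eqxx mulr1n.
by rewrite spd mxE.
Qed.

(** Once the list is sorted by decreasing absolute value, all entries from the second on are
    dominated by the second, so only the head can exceed it. *)
Lemma count_gt_sort_nth1 (R : realDomainType) (s : seq R) :
  (count (fun a : R => `|(sort (fun a b : R => `|b| <= `|a|) s)`_1| < `|a|)%R s <= 1)%N.
Proof.
pose le (a b : R) := `|b| <= `|a|; rewrite -/le; set t := sort le s.
have tot : total le by move=> a b; exact: le_total.
have tr : transitive le by move=> b a c /= ab bc; exact: le_trans bc ab.
have ps : perm_eq t s by rewrite perm_sort.
rewrite -(permP ps); have := sort_sorted tot s; rewrite -/t.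
case: t {ps} => [|x [|y t]] //=.
  by rewrite addn0; case: (_ < _).
move=> /andP[_] /(order_path_min tr) /allP yt.
rewrite ltxx add0n (_ : count _ t = 0%N) ?addn0; first by case: (_ < _).
by apply/eqP; rewrite -leqn0 leqNgt -has_count; apply/hasPn => z /yt; rewrite -leNgt.
Qed.

(** If the second entry satisfied [B], so would the first, making two. The condition on [B 0]
    handles lists of length at most one, where the second entry is the default 0. *)
Lemma sort_nth1N (R : realDomainType) (s : seq R) (B : pred R) :
  ~~ B 0 -> (forall a b : R, `|a| <= `|b| -> B a -> B b) -> (count B s <= 1)%N ->
  ~~ B (sort (fun a b : R => `|b| <= `|a|) s)`_1.
Proof.
pose le (a b : R) := `|b| <= `|a|; rewrite -/le; set t := sort le s => B0 upB.
have tot : total le by move=> a b; exact: le_total.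
have ps : perm_eq t s by rewrite perm_sort.
rewrite -(permP ps); have := sort_sorted tot s; rewrite -/t.
case: t {ps} => [|x [|y t]] //= /andP[yx _] c; apply/negP => By.
by move: c; rewrite By (upB _ _ yx By).
Qed.

Section Operators.
Context {R : realType} {T : finType}.
Implicit Types (p : T -> T -> R) (mu f g : T -> R).

Definition kapp p f x : R := \sum_y p x y * f y.

Definition wdot mu f g : R := \sum_x mu x * f x * g x.

Definition constant_fun f := forall x y, f x = f y.

Lemma wdotC mu f g : wdot mu f g = wdot mu g f.
Proof. by apply: eq_bigr => x _; rewrite mulrAC. Qed.

Lemma eq_wdot mu f f' g g' : f =1 f' -> g =1 g' -> wdot mu f g = wdot mu f' g'.
Proof. by move=> e e'; apply: eq_bigr => x _; rewrite e e'. Qed.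

Lemma eq_kapp p f g x : f =1 g -> kapp p f x = kapp p g x.
Proof. by move=> e; apply: eq_bigr => y _; rewrite e. Qed.

Lemma wdotxx mu f : wdot mu f f = \sum_x mu x * f x ^+ 2.
Proof. by apply: eq_bigr => x _; rewrite -mulrA expr2. Qed.

Lemma wdotZl mu a f g : wdot mu (fun x => a * f x) g = a * wdot mu f g.
Proof. by rewrite mulr_sumr; apply: eq_bigr => x _; rewrite !mulrA [mu x * a]mulrC. Qed.

Lemma wdot_kapp p mu f g : (forall x y, mu x * p x y = mu y * p y x) ->
  wdot mu f (kapp p g) = wdot mu (kapp p f) g.
Proof.
move=> rev; rewrite /wdot /kapp.
under eq_bigr do rewrite mulr_sumr; under [RHS]eq_bigr do rewrite mulr_sumr mulr_suml.
rewrite exchange_big; apply: eq_bigr => x _; apply: eq_bigr => y _.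
by rewrite [in RHS]mulrA rev; ring.
Qed.

Lemma wdot_gt0 mu f x : (forall x, 0 < mu x) -> f x != 0 -> 0 < wdot mu f f.
Proof.
move=> mu0 fx; rewrite /wdot (bigD1 x)//= ltr_pwDl//.
  by rewrite -mulrA mulr_gt0// -expr2 exprn_even_gt0.
by apply: sumr_ge0 => y _; rewrite -mulrA -expr2 mulr_ge0 ?sqr_ge0// ltW.
Qed.

Lemma wdot_ge0 mu f : (forall x, 0 < mu x) -> 0 <= wdot mu f f.
Proof.
by move=> mu0; apply: sumr_ge0 => y _; rewrite -mulrA -expr2 mulr_ge0 ?sqr_ge0// ltW.
Qed.

End Operators.

(** Both lists contain each [a] exactly as often as its multiplicity as a root of the characteristic
    polynomial. *)
Lemma perm_eigenvalues (R : realType) (T : finType) (p : T -> T -> R)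
    (d : 'I_#|T| -> R) :
  char_poly (transition_matrix p) = \prod_i ('X - (d i)%:P) ->
  perm_eq (eigenvalues p) [seq d i | i <- enum 'I_#|T|].
Proof.
move=> e; have {}e : char_poly (transition_matrix p) =
    \prod_(a <- [seq d i | i <- enum 'I_#|T|]) ('X - a%:P).
  by rewrite big_map big_enum.
have chi0 : char_poly (transition_matrix p) != 0 by rewrite monic_neq0 ?char_poly_monic.
apply/allP => /= a _; apply/eqP; rewrite -[RHS](mu_prod_XsubC a) -e /eigenvalues.
set chi := char_poly _ in chi0 *; rewrite count_flatten -map_comp.
have -> : sumn [seq (count_mem a \o (fun b => nseq (mup b chi) b)) i | i <- rootsR chi]
    = \sum_(b <- rootsR chi) (if b == a then mup a chi else 0%N).
  rewrite sumnE big_map; apply: eq_bigr => b _ /=.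
  by rewrite count_nseq /=; case: eqVneq => [->|]; rewrite ?mul1n.
rewrite -big_mkcond; case: (boolP (root chi a)) => ra; last first.
  by rewrite mupNroot// big1.
rewrite -big_filter filter_pred1_uniq ?big_seq1 ?uniq_roots//.
by rewrite -(roots_on_rootsR chi0) ra andbT in_itv.
Qed.

(** Conjugating [p] by the square root of [mu] gives a symmetric matrix. The rows of its unitary
    diagonalisation, divided by that square root, form a complex orthonormal eigenbasis
    [al i + 'i * be i]; the fourth clause is its Parseval identity. The last clause serves to show
    that the eigenvalue 1 is simple: the constants span one dimension only. *)
Lemma reversible_spectrum (R : realType) (T : finType) (p : T -> T -> R)
    (mu : T -> R) :
  (forall x, 0 < mu x) -> (forall x y, mu x * p x y = mu y * p y x) ->
  exists (d : 'I_#|T| -> R) (al be : 'I_#|T| -> T -> R),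
  [/\ perm_eq (eigenvalues p) [seq d i | i <- enum 'I_#|T|],
      forall i x, kapp p (al i) x = d i * al i x,
      forall i x, kapp p (be i) x = d i * be i x,
      forall f g, wdot mu f g = \sum_i (wdot mu (al i) f * wdot mu (al i) g +
                                        wdot mu (be i) f * wdot mu (be i) g)
    & forall i j, constant_fun (al i) -> constant_fun (be i) ->
        constant_fun (al j) -> constant_fun (be j) -> i = j].
Proof.
move=> mu0 rev; pose s x : R := Num.sqrt (mu x).
have s0 x : s x != 0 by rewrite gt_eqF// sqrtr_gt0.
have ss x : s x * s x = mu x by rewrite -expr2 sqr_sqrtr// ltW.
pose E (i : 'I_#|T|) := enum_val i.
have sumE (F : 'I_#|T| -> R) : \sum_j F j = \sum_y F (enum_rank y).
  by rewrite (reindex enum_rank)//; exact/onW_bij/enum_rank_bij.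
pose S := \matrix_(i, j) (s (E i) * p (E i) (E j) / s (E j)).
have symp x y : s x * p x y / s y = s y * p y x / s x.
  by apply/eqP; rewrite eqr_div// mulrAC ss rev -ss mulrAC.
have symS : S^T = S by apply/matrixP => i j; rewrite !mxE.
have [d [a [b [aS bS ab1 [ab2 ab3] chi]]]] := symmetric_mx_spectrum _ _ _ symS.
pose lift (c : 'M[R]_#|T|) i x := c i (enum_rank x) / s x.
have liftK c : c *m S = diag_mx d *m c ->
    forall i x, kapp p (lift c i) x = d 0 i * lift c i x.
  move=> /matrixP e i x; move: (e i (enum_rank x)).
  rewrite mul_diag_mx !mxE sumE /lift mulrA => <-.
  rewrite mulr_suml; apply: eq_bigr => y _; rewrite !mxE /E !enum_rankK symp.
  by field; rewrite !s0.
pose V (f : T -> R) := (\col_i (s (E i) * f (E i)))%R : 'cV[R]_#|T|.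
have liftV c i f : wdot mu (lift c i) f = (c *m V f) i 0.
  rewrite mxE sumE; apply: eq_bigr => x _; rewrite !mxE /E enum_rankK -ss /lift.
  by field; rewrite s0.
have dotV f g : wdot mu f g = ((V f)^T *m V g) 0 0.
  rewrite mxE sumE; apply: eq_bigr => x _; rewrite !mxE /E enum_rankK -ss; ring.
exists (fun i => d 0 i), (lift a), (lift b); split.
(* The transition matrix and [S] are similar through the diagonal matrix of the [s x]. *)
- apply: perm_eigenvalues; rewrite -chi /char_poly.
  pose D := diag_mx (\row_i s (E i)).
  have dD : \det (map_mx polyC D) != 0.
    rewrite det_map_mx polyC_eq0 det_diag; apply/prodf_neq0 => i _.
    by rewrite mxE.
  apply: (mulfI dD); rewrite [RHS]mulrC -!det_mulmx /char_poly_mx.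
  rewrite mulmxBl mulmxBr scalar_mxC -!map_mxM; congr (\det (_ - map_mx _ _)).
  rewrite mul_diag_mx mul_mx_diag; apply/matrixP => i j; rewrite !mxE.
  by rewrite divfK.
- exact: liftK.
- exact: liftK.
- move=> f g; rewrite dotV -[V g in LHS]mul1mx -ab1 mulmxDl mulmxDr mxE big_split.
  congr (_ + _); rewrite -!mulmxA mulmxA -trmx_mul mxE; apply: eq_bigr => i _;
    by rewrite mxE !liftV.
move=> i j ai bi aj bj; apply/eqP/negPn/negP => ij.
have cst c k : constant_fun (lift c k) ->
    exists z : R, forall x, c k (enum_rank x) = z * s x.
  move=> h; exists (lift c k (E i)) => x; rewrite (h _ x) /lift.
  by rewrite divfK.
have [zai {}ai] := cst _ _ ai; have [zbi {}bi] := cst _ _ bi.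
have [zaj {}aj] := cst _ _ aj; have [zbj {}bj] := cst _ _ bj.
pose Z := \sum_x mu x.
(* Rows that come from constant functions are multiples of [s], so their products reduce to products
   of the factors times the total mass [Z]. *)
have prodZ (c c' : 'M[R]_#|T|) k l z z' : (forall x, c k (enum_rank x) = z * s x) ->
    (forall x, c' l (enum_rank x) = z' * s x) -> (c *m c'^T) k l = z * z' * Z.
  move=> h h'; rewrite mxE sumE mulr_sumr; apply: eq_bigr => x _.
  by rewrite mxE h h' -ss; ring.
have h1 : (zai * zai + zbi * zbi) * Z = 1.
  rewrite mulrDl -(prodZ _ _ _ _ _ _ ai ai) -(prodZ _ _ _ _ _ _ bi bi).
  by have /matrixP/(_ i i) := ab2; rewrite !mxE eqxx.
have h2 : (zaj * zaj + zbj * zbj) * Z = 1.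
  rewrite mulrDl -(prodZ _ _ _ _ _ _ aj aj) -(prodZ _ _ _ _ _ _ bj bj).
  by have /matrixP/(_ j j) := ab2; rewrite !mxE eqxx.
have h3 : (zai * zaj + zbi * zbj) * Z = 0.
  rewrite mulrDl -(prodZ _ _ _ _ _ _ ai aj) -(prodZ _ _ _ _ _ _ bi bj).
  by have /matrixP/(_ i j) := ab2; rewrite !mxE (negPf ij).
have h4 : (zbi * zaj - zai * zbj) * Z = 0.
  rewrite mulrBl -(prodZ _ _ _ _ _ _ bi aj) -(prodZ _ _ _ _ _ _ ai bj).
  by rewrite ab3 subrr.
(* Lagrange's identity: two proportional orthogonal vectors are not both unit. *)
have : ((zai * zai + zbi * zbi) * Z) * ((zaj * zaj + zbj * zbj) * Z) =
  ((zai * zaj + zbi * zbj) * Z) ^+ 2 + ((zbi * zaj - zai * zbj) * Z) ^+ 2 by ring.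
rewrite h1 h2 h3 h4 expr0n addr0 mulr1 => /eqP.
by rewrite oner_eq0.
Qed.

(** * Variational bounds for the second eigenvalue *)

Section SpectralGap.
Context {R : realType} {T : finType}.
Variables (p : T -> T -> R) (mu : T -> R).
Hypotheses (mu_gt0 : forall x, 0 < mu x)
  (rev : forall x y, mu x * p x y = mu y * p y x).

(** Two indices with eigenvalues in [B] would both carry constant real and imaginary parts, hence
    coincide. *)
Lemma count_eigenvalues_le1 (B : pred R) :
  (forall a f, B a -> (forall x, kapp p f x = a * f x) -> constant_fun f) ->
  (count B (eigenvalues p) <= 1)%N.
Proof.
move=> hB; have [d [al [be [pd eal ebe _ inj]]]] := reversible_spectrum R T p mu mu_gt0 rev.
rewrite (permP pd) count_map -size_filter.
set l := [seq _ <- _ | _]; have ul : uniq l by rewrite filter_uniq ?enum_uniq.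
have : all (preim d B) l by exact: filter_all.
case: l ul => [|i [|j l]] //= /andP[+ _] /and3P[Bi Bj _].
rewrite inE negb_or => /andP[/eqP ij _]; exfalso; apply: ij.
by apply: inj; (apply: hB; last by [exact: eal|exact: ebe]).
Qed.

Lemma lambda2_le (r : R) : 0 <= r ->
  (forall a f, r < `|a| -> (forall x, kapp p f x = a * f x) -> constant_fun f) ->
  `|lambda2 p| <= r.
Proof.
move=> r0 hr; rewrite leNgt.
apply: (sort_nth1N _ _ (fun a : R => r < `|a|)).
- by rewrite normr0 -leNgt.
- by move=> a b ab ra; exact: lt_le_trans ra ab.
- exact: count_eigenvalues_le1.
Qed.

Hypothesis p1 : forall x, \sum_y p x y = 1.

Lemma kapp_const c x : kapp p (fun=> c) x = c.
Proof. by rewrite /kapp -mulr_suml p1 mul1r. Qed.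

(** Self-adjointness against the fixed function 1 gives [<f, 1> = a <f, 1>]. *)
Lemma eigenfun_mean0 a f : (forall x, kapp p f x = a * f x) -> a != 1 ->
  wdot mu f (fun=> 1) = 0.
Proof.
move=> e a1; have : wdot mu f (fun=> 1) = a * wdot mu f (fun=> 1).
  rewrite -wdotZl -(eq_wdot mu _ _ _ _ e (fun=> erefl)) -wdot_kapp//.
  by apply: eq_wdot => // x; rewrite kapp_const.
move=> /eqP; rewrite -subr_eq0 -{1}[wdot _ _ _]mul1r -mulrBl mulf_eq0 subr_eq0.
by rewrite eq_sym (negPf a1) => /eqP.
Qed.

Hypothesis gap : forall a f, 1 <= `|a| ->
  (forall x, kapp p f x = a * f x) -> constant_fun f.

Lemma lambda2_lt1 : `|lambda2 p| < 1.
Proof.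
rewrite ltNge; apply: (sort_nth1N _ _ (fun a : R => 1 <= `|a|)).
- by rewrite normr0 -ltNge.
- by move=> a b ab ra; exact: le_trans ra ab.
- exact: count_eigenvalues_le1.
Qed.

(** Were 1 not among the [d i], every eigenfunction would have mean zero, and Parseval applied to
    the function 1 would give total mass 0. *)
Lemma eigenvalue1 (x0 : T) (d : 'I_#|T| -> R) (al be : 'I_#|T| -> T -> R) :
  (forall i x, kapp p (al i) x = d i * al i x) ->
  (forall i x, kapp p (be i) x = d i * be i x) ->
  (forall f g, wdot mu f g = \sum_i (wdot mu (al i) f * wdot mu (al i) g +
                                      wdot mu (be i) f * wdot mu (be i) g)) ->
  exists j, d j = 1.
Proof.
move=> eal ebe dot.
have : 0 < wdot mu (fun=> 1) (fun=> 1).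
  by apply: (wdot_gt0 _ _ x0) => //; rewrite oner_eq0.
have [/existsP[j /eqP dj] _|/existsPn d1] := boolP [exists j, d j == 1]; first by exists j.
rewrite dot big1 ?ltxx// => i _.
by rewrite !(eigenfun_mean0 (d i)) ?mulr0 ?addr0.
Qed.

Lemma lambda2_eigenfun : (1 < #|T|)%N ->
  exists f x, [/\ f x != 0, wdot mu f (fun=> 1) = 0 &
                  forall x, kapp p f x = lambda2 p * f x].
Proof.
move=> T1; have [d [al [be [pd eal ebe dot inj]]]] :=
  reversible_spectrum R T p mu mu_gt0 rev.
have := lambda2_lt1; have : lambda2 p \in eigenvalues p.
  rewrite -(mem_sort (fun a b : R => `|b| <= `|a|)) mem_nth//.
  by rewrite size_sort (perm_size pd) size_map size_enum_ord.
rewrite (perm_mem pd) => /mapP[i _ ->] di1.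
have di : d i != 1 by apply: contraTneq di1 => ->; rewrite normr1 ltxx.
have [/existsP[x fx]|/existsPn al0] := boolP [exists x, al i x != 0].
  by exists (al i), x; split => //; exact: eigenfun_mean0 (eal i) di.
have [/existsP[x fx]|/existsPn be0] := boolP [exists x, be i x != 0].
  by exists (be i), x; split => //; exact: eigenfun_mean0 (ebe i) di.
have zc (f : T -> R) : (forall x, ~~ (f x != 0 :> R)) -> constant_fun f.
  by move=> f0 x y; move: (f0 x) (f0 y); rewrite !negbK => /eqP -> /eqP ->.
(* If both parts at [i] vanish they are constant, as are those at an index of eigenvalue 1; the
   indices then agree, although [d i] is not 1. *)
have [j dj] := eigenvalue1 (enum_val i) d al be eal ebe dot.
have aj : constant_fun (al j) by apply: gap (eal j); rewrite dj normr1.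
have bj : constant_fun (be j) by apply: gap (ebe j); rewrite dj normr1.
by move: di; rewrite (inj _ _ (zc _ al0) (zc _ be0) aj bj) dj eqxx.
Qed.

(** The [w i] form the spectral measure of [f], the squared moduli of its coefficients; the three
    sums are its moments of order 0, 1 and 2. *)
Lemma spectral_weights f : wdot mu f (fun=> 1) = 0 ->
  exists (d w : 'I_#|T| -> R),
    [/\ forall i, 0 <= w i, forall i, w i = 0 \/ `|d i| <= `|lambda2 p|,
        wdot mu f f = \sum_i w i, wdot mu f (kapp p f) = \sum_i d i * w i &
        wdot mu (kapp p f) (kapp p f) = \sum_i d i ^+ 2 * w i].
Proof.
move=> f0; have [d [al [be [pd eal ebe dot inj]]]] :=
  reversible_spectrum R T p mu mu_gt0 rev.
have ep c i g : (forall x, kapp p c x = d i * c x) ->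
    wdot mu c (kapp p g) = d i * wdot mu c g.
  by move=> e; rewrite wdot_kapp// (eq_wdot mu _ _ _ _ e (fun=> erefl)) wdotZl.
exists d, (fun i => wdot mu (al i) f ^+ 2 + wdot mu (be i) f ^+ 2); split.
- by move=> i; rewrite addr_ge0// sqr_ge0.
- move=> i; have [|li] := lerP `|d i| `|lambda2 p|; [by right|left].
  (* Beyond [lambda2] in modulus there are two cases. If [|d i| >= 1], the eigenfunctions are
     constant, hence orthogonal to [f]. Otherwise [i] and an index of eigenvalue 1 are two distinct
     entries above the second largest. *)
  have [i1|i1] := lerP 1 `|d i|.
    have cf c : constant_fun c -> wdot mu c f = 0.
      move=> cc; rewrite (eq_wdot mu _ (fun x => c (enum_val i) * 1) _ f)//.
        by rewrite wdotZl wdotC f0 mulr0.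
      by move=> x; rewrite mulr1.
    rewrite !cf ?expr0n ?addr0//.
      exact: gap i1 (ebe i).
    exact: gap i1 (eal i).
  have [j dj] := eigenvalue1 (enum_val i) d al be eal ebe dot.
  have ij : i != j by apply: contraTneq i1 => ->; rewrite dj normr1 ltxx.
  have := count_gt_sort_nth1 _ (eigenvalues p); rewrite -/(lambda2 p) (permP pd).
  rewrite count_map -size_filter leqNgt => /negP[].
  have <- : size [:: i; j] = 2%N by [].
  apply: uniq_leq_size; first by rewrite /= inE ij.
  move=> k; rewrite !inE mem_filter mem_enum andbT /= => /orP[]/eqP -> //.
  by rewrite dj normr1; exact: lt_trans li i1.
- by rewrite dot.
- by rewrite dot; apply: eq_bigr => i _; rewrite !(ep _ i)//; ring.
- by rewrite dot; apply: eq_bigr => i _; rewrite !(ep _ i)//; ring.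
Qed.

Lemma norm_kapp_le f : wdot mu f (fun=> 1) = 0 ->
  wdot mu (kapp p f) (kapp p f) <= lambda2 p ^+ 2 * wdot mu f f.
Proof.
move=> /spectral_weights[d [w [w0 dw -> _ ->]]]; rewrite mulr_sumr.
apply: ler_sum => i _; case: (dw i) => [->|h]; first by rewrite !mulr0.
by rewrite ler_wpM2r// -[d i ^+ 2]real_normK ?num_real// -[leRHS]real_normK ?num_real//
  lerXn2r// nnegrE.
Qed.

Lemma rayleigh_le f : wdot mu f (fun=> 1) = 0 ->
  wdot mu f (kapp p f) <= `|lambda2 p| * wdot mu f f.
Proof.
move=> /spectral_weights[d [w [w0 dw -> -> _]]]; rewrite mulr_sumr.
apply: ler_sum => i _; case: (dw i) => [->|h]; first by rewrite !mulr0.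
by rewrite ler_wpM2r// (le_trans _ h)// ler_norm.
Qed.

End SpectralGap.

(** * Irreducible and aperiodic chains *)

Section Ergodic.
Context {R : realType} {T : finType}.
Variable p : T -> T -> R.
Hypothesis stoch : stochastic p.

Let p0 x y : 0 <= p x y. Proof. by case: stoch. Qed.
Let p1 x : \sum_y p x y = 1. Proof. by case: stoch. Qed.

Lemma kpow_ge0 t x y : 0 <= kpow p t x y.
Proof.
by elim: t x => [|t IH] x /=; rewrite ?ler0n//; apply: sumr_ge0 => z _; rewrite mulr_ge0.
Qed.

Lemma kpowS_gt0 t x y : 0 < kpow p t.+1 x y ->
  exists z, 0 < p x z /\ 0 < kpow p t z y.
Proof.
move=> /= h; have : \sum_z p x z * kpow p t z y != 0 by rewrite gt_eqF.
rewrite psumr_neq0 => [/hasP[z _ /=]|z _]; last by rewrite mulr_ge0 ?kpow_ge0.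
move=> pz; exists z; move: pz; rewrite !lt_def p0 kpow_ge0 mulr_ge0 ?kpow_ge0// !andbT.
by rewrite mulf_eq0 negb_or => /andP[].
Qed.

(** Induction along trajectories of positive probability; the second argument of [A] counts the
    steps. *)
Lemma kpow_ind (A : T -> nat -> Prop) x y t :
  A x 0%N -> (forall z z' s, A z s -> 0 < p z z' -> A z' s.+1) ->
  0 < kpow p t x y -> A y t.
Proof.
move=> Ax step; suff gen s : A x s -> 0 < kpow p t x y -> A y (s + t)%N by exact: (gen 0%N).
elim: t s x {Ax} => [|t IH] s x Ax.
  by rewrite /= ltr0n addn0 lt0b => /eqP <-.
by move=> /kpowS_gt0[z [pz kz]]; rewrite addnS -addSn; apply: IH kz; exact: step pz.
Qed.

Lemma reversible_gt0 (mu : T -> R) : irreducible_chain p ->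
  (forall x, 0 <= mu x) -> \sum_x mu x = 1 ->
  (forall x y, mu x * p x y = mu y * p y x) -> forall x, 0 < mu x.
Proof.
move=> irr mu0 mu1 rev y.
have : \sum_x mu x != 0 by rewrite mu1 oner_eq0.
rewrite psumr_neq0// => /hasP[x _ /= mx]; have [t] := irr x y.
apply: (kpow_ind (fun z _ => 0 < mu z)); first by [].
move=> z z' _ mz pz; rewrite lt_def mu0 andbT; apply/negP => /eqP e.
by have := rev z z'; rewrite e mul0r => /eqP; rewrite gt_eqF// mulr_gt0.
Qed.

Lemma eigenvalue_le1 a f x : (forall x, kapp p f x = a * f x) ->
  (forall y, `|f y| <= `|f x|) -> `|a| * `|f x| <= `|f x|.
Proof.
move=> e mx; rewrite -normrM -e -[leRHS]mul1r -(p1 x) mulr_suml.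
apply: (le_trans (ler_norm_sum _ _ _)); apply: ler_sum => y _.
by rewrite normrM ger0_norm// ler_wpM2l.
Qed.

(* A maximum of [`|f|] propagates along the transitions, with a factor [a]. *)
Lemma ergodic_eigenfun_constant : irreducible_chain p -> aperiodic_chain p ->
  forall a f, 1 <= `|a| -> (forall x, kapp p f x = a * f x) -> constant_fun f.
Proof.
move=> irr aper a f a1 e u v.
pose x := [arg max_(x > u) `|f x|]%O.
have mx y : `|f y| <= `|f x|.
  by rewrite /x; case: arg_maxP => // i _; apply.
have [fx0|fx0] := eqVneq (f x) 0.
  have f0 y : f y = 0 by apply/eqP; rewrite -normr_le0 (le_trans (mx y))// fx0 normr0.
  by rewrite !f0.
have {}a1 : `|a| = 1.
  apply/le_anti; rewrite a1 andbT.
  by have := eigenvalue_le1 _ _ _ e mx; rewrite ger_pMl// normr_gt0.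
have step z z' : `|f z| = `|f x| -> 0 < p z z' -> f z' = a * f z.
  move=> fz pz; pose c := a * f z.
  have nc : `|c| = `|f x| by rewrite normrM a1 mul1r.
  (* Since [|c|] is the maximum of [|f|], the terms [c * (c - f y)] are nonnegative; their average
     under [p z] is 0, so [f y = c] at every successor. *)
  have cge y : 0 <= p z y * (c * (c - f y)).
    rewrite mulr_ge0// mulrBr subr_ge0 (le_trans (ler_norm _))// normrM nc.
    by rewrite -expr2 -[c ^+ 2]real_normK ?num_real// nc expr2 ler_wpM2l.
  have : \sum_y p z y * (c * (c - f y)) = 0.
    under eq_bigr do rewrite mulrCA.
    rewrite -mulr_sumr (_ : \sum__ _ = 0) ?mulr0//.
    under eq_bigr do rewrite mulrBr.
    by rewrite sumrB -mulr_suml p1 mul1r -/(kapp p f z) e subrr.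
  move=> /eqP; rewrite psumr_eq0// => /allP/(_ z' (mem_index_enum _))/=.
  rewrite mulf_eq0 gt_eqF//= mulf_eq0 subr_eq0 -normr_eq0 nc normr_eq0 (negPf fx0)/=.
  by move=> /eqP.
have path t y : 0 < kpow p t x y -> f y = a ^+ t * f x /\ `|f y| = `|f x|.
  apply: (kpow_ind (fun y t => f y = a ^+ t * f x /\ `|f y| = `|f x|)).
    by rewrite mul1r.
  move=> z z' s [fz nz] pz; rewrite (step _ _ nz pz) normrM a1 mul1r; split => //.
  by rewrite exprS -mulrA -fz.
have [|aN1] : a = 1 \/ a = -1.
  by case: (ger0P a) a1 => _ e1; [left|right; rewrite -e1 opprK].
- move=> a_1; have [t /path[-> _]] := irr x u; have [s /path[-> _]] := irr x v.
  by rewrite a_1 !expr1n.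
(* For [a = -1], a return to [x] after [t] steps forces [f x = (-1)^t f x], so every return time is
   even, against aperiodicity. *)
have : 2%N = 1%N.
  apply: (aper x) => t _ /path[h _]; rewrite dvdn2; apply/negP => ot.
  move: h; rewrite aN1 -signr_odd ot expr1 mulN1r => /eqP.
  by rewrite -addr_eq0 -mulr2n mulrn_eq0 (negPf fx0).
by [].
Qed.

End Ergodic.

(** * Hitting times *)

Section HitAt.
Context {R : realType} {T : finType}.
Variable p : T -> T -> R.

Lemma hit_at0 x y : hit_at p x y 0 = (x == y)%:R.
Proof.
rewrite /hit_at; under eq_bigr do rewrite big_ord0.
case: eqVneq => [->|xy].
  apply: (big_pred1 ([ffun=> y] : {ffun 'I_1 -> T})) => w /=.
  apply/and3P/eqP => [[/eqP w0 _ _]|->].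
    by apply/ffunP => i; rewrite !ffunE ord1.
  by rewrite !ffunE !eqxx; split => //; apply/forallP.
apply: big_pred0 => w; apply/negbTE; rewrite !negb_and.
have -> : ord_max = ord0 :> 'I_1 by rewrite [LHS]ord1.
by case: eqVneq => //= ->; rewrite xy.
Qed.

(** First-step decomposition. The map [h] below prepends [x] to a trajectory; for [x = y] the
    avoidance condition already fails at time 0. *)
Lemma hit_atS x y t : hit_at p x y t.+1 =
  if x == y then 0 else \sum_z p x z * hit_at p z y t.
Proof.
pose h (g : {ffun 'I_t.+1 -> T}) : {ffun 'I_t.+2 -> T} :=
  [ffun i => if unlift ord0 i is Some j then g j else x].
have h0 g : h g ord0 = x by rewrite ffunE unlift_none.
have hS g j : h g (lift ord0 j) = g j by rewrite ffunE liftK.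
have hS' g k : (k <= t)%N -> h g (inord k.+1) = g (inord k).
  move=> kt; rewrite -hS; congr (h g _); apply: val_inj.
  by rewrite /= /bump /= !inordK.
rewrite /hit_at.
rewrite (reindex_onto h (fun w => [ffun j => w (lift ord0 j)])) /=; last first.
  move=> w /andP[/eqP w0 _]; apply/ffunP => i; rewrite ffunE.
  by case: unliftP => [j ->|->]; rewrite ?ffunE.
under eq_bigl => g.
  rewrite h0 eqxx /= (_ : [ffun j => h g (lift ord0 j)] == g); last first.
    by apply/eqP/ffunP => j; rewrite ffunE hS.
  rewrite andbT (_ : ord_max = lift ord0 ord_max) ?hS; last exact: val_inj.
  over.
have [xy|xy] := eqVneq x y.
  apply: big_pred0 => g; apply/negbTE; rewrite negb_and; apply/orP; right.
  by apply/forallPn; exists ord0; rewrite /= h0 xy eqxx.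
rewrite (partition_big (fun g : {ffun _} => g ord0) predT)//=.
apply: eq_bigr => z _; rewrite mulr_sumr; apply: eq_big => [g|g /andP[_ /eqP gz]].
  rewrite andbC; congr (_ && (_ && _)).
  apply/forallP/forallP => a i.
    by have := a (lift ord0 i); rewrite hS.
  case: (unliftP ord0 i) => [j ->|->]; last by rewrite h0 xy implybT.
  by rewrite hS; exact: a.
rewrite big_ord_recl; congr (_ * _).
  rewrite (_ : inord _ = ord0) ?h0 ?hS'//; last by apply: val_inj; rewrite /= inordK.
  by rewrite -gz; congr (p x (g _)); apply: val_inj; rewrite /= inordK.
by apply: eq_bigr => i _; rewrite !lift0 !hS' // ltnW.
Qed.

Hypothesis stoch : stochastic p.

Lemma hit_at_ge0 x y t : 0 <= hit_at p x y t.
Proof. by apply: sumr_ge0 => w _; apply: prodr_ge0 => i _; case: stoch. Qed.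

Lemma kapp_le f g x : (forall x, f x <= g x) -> kapp p f x <= kapp p g x.
Proof. by move=> fg; apply: ler_sum => y _; apply: ler_wpM2l => //; case: stoch. Qed.

Lemma kappD f g x : kapp p (fun x => f x + g x) x = kapp p f x + kapp p g x.
Proof. by rewrite -big_split; apply: eq_bigr => y _; rewrite mulrDr. Qed.

Lemma kappZ c f x : kapp p (fun x => c * f x) x = c * kapp p f x.
Proof. by rewrite mulr_sumr; apply: eq_bigr => y _; rewrite mulrCA. Qed.

End HitAt.

Section HittingTime.
Context {R : realType} {T : finType}.
Variables (p : T -> T -> R) (v : T).
Hypotheses (stoch : stochastic p) (irr : irreducible_chain p).

Let p0 x y : 0 <= p x y. Proof. by case: stoch. Qed.
Let p1 x : \sum_y p x y = 1. Proof. by case: stoch. Qed.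

(** A negative minimum would lie off [v]. Superharmonicity spreads its value to all successors, and
    irreducibility carries it to [v], where [u] is nonnegative. *)
Lemma minimum_principle (u : T -> R) : 0 <= u v ->
  (forall x, x != v -> kapp p u x <= u x) -> forall x, 0 <= u x.
Proof.
move=> uv sup x0; pose m := [arg min_(x < x0) u x]%O.
have mP y : u m <= u y by rewrite /m; case: arg_minP => // i _; apply.
rewrite (le_trans _ (mP x0))// leNgt; apply/negP => m0.
have [t] := irr m v; suff : forall y t, 0 < kpow p t m y -> u y = u m.
  by move=> h /h e; move: uv; rewrite e leNgt m0.
move=> y {}t; apply: (kpow_ind _ stoch (fun z _ => u z = u m)) => // z z' _ uz pz.
have zv : z != v by apply: contraTneq m0 => e; rewrite -uz e -leNgt.
have c0 y' : 0 <= p z y' * (u y' - u m) by rewrite mulr_ge0// subr_ge0.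
have : \sum_y' p z y' * (u y' - u m) = 0.
  apply/le_anti; rewrite sumr_ge0 ?andbT//.
  under eq_bigr do rewrite mulrBr.
  by rewrite sumrB -mulr_suml p1 mul1r subr_le0 -uz; exact: sup.
move=> /eqP; rewrite psumr_eq0// => /allP/(_ z' (mem_index_enum _))/=.
by rewrite mulf_eq0 gt_eqF//= subr_eq0 => /eqP.
Qed.

(** The square linear system is solvable because its kernel is trivial, by the minimum principle
    applied to a kernel vector and its opposite ([s = 1] and [s = -1] below). *)
Lemma hitting_system : exists w : T -> R,
  [/\ w v = 0, forall x, x != v -> w x = 1 + kapp p w x & forall x, 0 <= w x].
Proof.
pose E (i : 'I_#|T|) : T := enum_val i.
have sumE (F : 'I_#|T| -> R) : \sum_j F j = \sum_y F (enum_rank y).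
  by rewrite (reindex enum_rank)//; exact/onW_bij/enum_rank_bij.
pose A : 'M[R]_#|T| :=
  \matrix_(j, i) ((j == i)%:R - (if E i == v then 0 else p (E i) (E j))).
have AE (u : 'rV[R]_#|T|) x : (u *m A) 0 (enum_rank x) =
    u 0 (enum_rank x) - (if x == v then 0 else kapp p (fun y => u 0 (enum_rank y)) x).
  rewrite mxE; under eq_bigr do rewrite mxE mulrBr.
  rewrite sumrB; congr (_ - _).
    rewrite (bigD1 (enum_rank x))//= eqxx mulr1 big1 ?addr0// => j /negPf ->.
    by rewrite mulr0.
  rewrite sumE /E enum_rankK; case: ifP => _; first by apply: big1 => j _; rewrite mulr0.
  by apply: eq_bigr => y _; rewrite enum_rankK mulrC.
have uA : A \in unitmx.
  rewrite -row_free_unit; apply: inj_row_free => u uA0.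
  pose U s x : R := s * u 0 (enum_rank x).
  have Us s x : 0 <= U s x.
    apply: minimum_principle => [|{}x xv]; rewrite /U ?kappZ.
      by have := AE u v; rewrite uA0 mxE eqxx subr0 => <-; rewrite mulr0.
    have := AE u x; rewrite uA0 mxE (negPf xv) => /esym/eqP.
    by rewrite subr_eq0 => /eqP <-.
  apply/rowP => i; rewrite mxE -(enum_valK i); apply/le_anti.
  have := Us 1 (E i); have := Us (-1) (E i); rewrite /U mulN1r mul1r oppr_ge0.
  by move=> -> ->.
pose b : 'rV[R]_#|T| := \row_i (E i != v)%:R.
pose u := b *m invmx A.
have uAb : u *m A = b by rewrite mulmxKV.
exists (fun x => u 0 (enum_rank x)).
have w0 : u 0 (enum_rank v) = 0.
  by have := AE u v; rewrite uAb mxE /E enum_rankK eqxx subr0.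
have w1 x : x != v -> u 0 (enum_rank x) = 1 + kapp p (fun x => u 0 (enum_rank x)) x.
  move=> xv; have := AE u x; rewrite uAb mxE /E enum_rankK xv (negPf xv) => /esym/eqP.
  by rewrite subr_eq => /eqP.
split => //; apply: minimum_principle; first by rewrite w0.
by move=> x xv; rewrite [leRHS]w1// lerDr.
Qed.

End HittingTime.

(** * The expected hitting time as solution of the linear system *)

Section ExpectedHit.
Context {R : realType} {T : finType}.
Variables (p : T -> T -> R) (v : T) (w : T -> R).
Hypotheses (stoch : stochastic p) (wv : w v = 0)
  (wE : forall x, x != v -> w x = 1 + kapp p w x) (w0 : forall x, 0 <= w x).

Let p0 x y : 0 <= p x y. Proof. by case: stoch. Qed.
Let p1 x : \sum_y p x y = 1. Proof. by case: stoch. Qed.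

(* [survival t x] is the probability, from [x], that [v] is not visited up to time [t]. *)
Fixpoint survival t x : R :=
  if t is t'.+1 then (if x == v then 0 else kapp p (survival t') x)
  else (x != v)%:R.

Lemma hit_at_survival t x : hit_at p x v t =
  if t is t'.+1 then survival t' x - survival t x else 1 - survival 0 x.
Proof.
elim: t x => [|t IH] x.
  by rewrite hit_at0 /=; case: eqVneq => _; rewrite ?subr0 ?subrr.
rewrite hit_atS; case: t IH => [|t] IH.
  rewrite /=; case: (eqVneq x v) => [|xv]; first by rewrite subr0.
  under eq_bigr do rewrite IH mulrBr mulr1.
  by rewrite sumrB p1.
rewrite /=; case: (eqVneq x v) => [|xv]; first by rewrite subr0.
by under eq_bigr do rewrite IH mulrBr; rewrite sumrB.
Qed.

Lemma survival_ge0 t x : 0 <= survival t x.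
Proof.
elim: t x => [|t IH] x /=; first by rewrite ler0n.
by case: eqP => // _; apply: sumr_ge0 => y _; rewrite mulr_ge0.
Qed.

Lemma survival_anti s t x : (s <= t)%N -> survival t x <= survival s x.
Proof.
move=> /subnK <-; elim: (t - s)%N => [|k IH]; first by rewrite add0n.
rewrite addSn (le_trans _ IH)// -subr_ge0.
by have := hit_at_survival (k + s).+1 x => /= <-; exact: hit_at_ge0.
Qed.

Lemma sum_survivalS N x : \sum_(t < N.+1) survival t x =
  if x == v then 0 else 1 + kapp p (fun x => \sum_(t < N) survival t x) x.
Proof.
rewrite big_ord_recl /=; case: (eqVneq x v) => [_|xv]; first by rewrite big1 ?addr0.
congr (_ + _); rewrite /kapp; under [RHS]eq_bigr do rewrite mulr_sumr.
by rewrite exchange_big.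
Qed.

Lemma sum_survival_le N x : \sum_(t < N) survival t x <= w x.
Proof.
elim: N x => [|N IH] x; first by rewrite big_ord0.
rewrite sum_survivalS; case: (eqVneq x v) => // xv.
by rewrite wE// lerD2l; exact: kapp_le.
Qed.

(** What is missing from the sum up to [N] is the expected remaining time on the event of survival,
    at most [C] from any position. *)
Lemma sum_survival_ge N C x : (forall x, w x <= C) ->
  w x <= \sum_(t < N) survival t x + C * survival N x.
Proof.
move=> wC; elim: N x => [|N IH] x.
  rewrite big_ord0 add0r /=; case: (eqVneq x v) => [->|_] /=.
    by rewrite wv mulr0.
  by rewrite mulr1.
rewrite sum_survivalS /=; case: (eqVneq x v) => [->|xv].
  by rewrite wv mulr0 addr0.
by rewrite wE// -addrA lerD2l -kappZ -kappD; exact: kapp_le.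
Qed.

(** Summation by parts, [hit_at] being the decrement of [survival]. *)
Lemma sum_hit_at N x : \sum_(t < N.+1) t%:R * hit_at p x v t =
  \sum_(t < N) survival t x - N%:R * survival N x.
Proof.
elim: N => [|N IH].
  by rewrite big_ord_recr !big_ord0 /= !mul0r addr0 subr0.
rewrite big_ord_recr IH hit_at_survival [in RHS]big_ord_recr /=.
rewrite -[(N.+1)%:R]natr1; ring.
Qed.

(** Markov's inequality for the hitting time. *)
Lemma survival_le n x : n%:R * survival n x <= w x.
Proof.
apply: le_trans (sum_survival_le n x).
rewrite -[n in n%:R]card_ord mulr_natl -sumr_const; apply: ler_sum => i _.
by apply: survival_anti; exact: ltnW.
Qed.

Lemma sum_survival_mono k m x : (k <= m)%N ->
  \sum_(t < k) survival t x - k%:R * survival m x <=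
  \sum_(t < m) survival t x - m%:R * survival m x.
Proof.
move=> km; have cE n : n%:R * survival m x = \sum_(t < n) survival m x.
  by rewrite sumr_const card_ord mulr_natl.
rewrite !cE -!sumrB (big_ord_widen _ (fun t => survival t x - survival m x) km).
rewrite big_mkcond; apply: ler_sum => i _.
have h : 0 <= survival i x - survival m x.
  by rewrite subr_ge0; apply: survival_anti; exact: ltnW.
by case: ifP.
Qed.

(** Two scales are used: stopping the survival sum at [k] costs at most [C * survival k], and the
    boundary term costs [k * survival (k * k)]. By Markov both are of order [1 / k]. *)
Lemma sum_hit_at_ge k C x : (forall x, w x <= C) -> (0 < k)%N ->
  w x - (C + 1) * w x / k%:R <=
    \sum_(t < (k * k).+1) t%:R * hit_at p x v t.
Proof.
move=> wC k0; rewrite sum_hit_at.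
have : (k <= k * k)%N by rewrite leq_pmulr.
move: (natrM R k k); move: (k * k)%N => m km lkm.
have K0 : 0 < k%:R :> R by rewrite ltr0n.
have C0 : 0 <= C by exact: le_trans (w0 x) (wC x).
have hK : survival k x <= w x / k%:R by rewrite ler_pdivlMr// mulrC survival_le.
have hM : k%:R * survival m x <= w x / k%:R.
  by rewrite ler_pdivlMr// mulrAC -km survival_le.
have := sum_survival_mono k m x lkm.
have := sum_survival_ge k C x wC.
have : C * survival k x <= C * (w x / k%:R) by rewrite ler_wpM2l.
rewrite -[(C + 1) * _ / _]mulrA mulrDl mul1r; lra.
Qed.

Lemma expected_hitE x : expected_hit p x v = (w x)%:E.
Proof.
pose C := \sum_y w y.
have wC y : w y <= C by rewrite /C (bigD1 y)//= lerDl sumr_ge0.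
have h0 n : (0 <= (n%:R * hit_at p x v n)%:E)%E.
  by rewrite lee_fin mulr_ge0// hit_at_ge0.
have le_w : (expected_hit p x v <= (w x)%:E)%E.
  apply: lime_le; first by apply: is_cvg_nneseries => n _ _; exact: h0.
  apply: nearW => -[|n]; first by rewrite big_geq// lee_fin.
  rewrite big_mkord sumEFin lee_fin sum_hit_at (le_trans _ (sum_survival_le n x))//.
  by rewrite gerBl mulr_ge0// survival_ge0.
have ge_w k : (0 < k)%N -> ((w x - (C + 1) * w x / k%:R)%:E <= expected_hit p x v)%E.
  move=> k0; rewrite (le_trans _ (nneseries_lim_ge (k * k).+1 _))//.
  by rewrite big_mkord sumEFin lee_fin sum_hit_at_ge.
move: (expected_hit p x v) le_w ge_w => [r| |] //=; last by move=> _ /(_ 1%N isT).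
rewrite lee_fin => rw ge_w; congr EFin; apply/le_anti; rewrite rw /= leNgt.
apply/negP => lt; have dpos : 0 < w x - r by rewrite subr_gt0.
set y := (C + 1) * w x in ge_w.
have y0 : 0 <= y / (w x - r).
  by rewrite divr_ge0 ?(ltW dpos)// mulr_ge0// addr_ge0// sumr_ge0.
(* The index [k] is taken above [y / (w x - r)], making the error [y / k] smaller than the supposed
   deficit. *)
have := archi_boundP y0; have := ge_w (Num.bound (y / (w x - r))).+1 isT.
set b := Num.bound _; rewrite lee_fin lerBlDl -lerBlDr.
rewrite ler_pdivlMr ?ltr0n// ltr_pdivrMr// -natr1 => h1 h2.
by move: (le_lt_trans h1 h2); rewrite mulrC ltr_pM2r// ltNge lerDl ler01.
Qed.

End ExpectedHit.

(** * Dirichlet form of a symmetric chain *)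

Section Dirichlet.
Context {R : realType} {V : finType}.
Variable p : V -> V -> R.
Hypotheses (stoch : stochastic p) (sym : forall x y, p x y = p y x).
Implicit Types u w : V -> R.

Let p0 x y : 0 <= p x y. Proof. by case: stoch. Qed.
Let p1 x : \sum_y p x y = 1. Proof. by case: stoch. Qed.
Let p1' y : \sum_x p x y = 1. Proof. by under eq_bigr do rewrite sym. Qed.

Definition dirichlet u : R := \sum_x u x * (u x - kapp p u x).

Lemma dirichletE u :
  dirichlet u = 2^-1 * \sum_x \sum_y p x y * (u x - u y) ^+ 2.
Proof.
have e1 : \sum_x \sum_y p x y * u x ^+ 2 = \sum_x u x ^+ 2.
  by apply: eq_bigr => x _; rewrite -mulr_suml p1 mul1r.
have e2 : \sum_x \sum_y p x y * u y ^+ 2 = \sum_x u x ^+ 2.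
  by rewrite exchange_big; apply: eq_bigr => x _; rewrite -mulr_suml p1' mul1r.
have e3 : \sum_x \sum_y p x y * (u x * u y) = \sum_x u x * kapp p u x.
  apply: eq_bigr => x _; rewrite mulr_sumr; apply: eq_bigr => y _; ring.
have -> : \sum_x \sum_y p x y * (u x - u y) ^+ 2 =
    \sum_x \sum_y p x y * u x ^+ 2 + \sum_x \sum_y p x y * u y ^+ 2
    - 2 * \sum_x \sum_y p x y * (u x * u y).
  rewrite mulr_sumr -big_split -sumrB; apply: eq_bigr => x _ /=.
  by rewrite mulr_sumr -big_split -sumrB; apply: eq_bigr => y _ /=; ring.
rewrite e1 e2 e3 /dirichlet; under eq_bigr do rewrite mulrBr -expr2.
by rewrite sumrB; field.
Qed.

Lemma dirichlet_ge0 u : 0 <= dirichlet u.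
Proof.
rewrite dirichletE mulr_ge0 ?invr_ge0//; apply: sumr_ge0 => x _; apply: sumr_ge0 => y _.
by rewrite mulr_ge0// sqr_ge0.
Qed.

Lemma dirichletB u c : dirichlet (fun x => u x - c) = dirichlet u.
Proof.
rewrite !dirichletE; congr (_ * _); apply: eq_bigr => x _; apply: eq_bigr => y _.
by congr (_ * _ ^+ 2); ring.
Qed.

Section Target.
Variables (v : V) (w : V -> R).
Hypotheses (wv : w v = 0)
  (wE : forall x, x != v -> w x = 1 + kapp p w x) (w0 : forall x, 0 <= w x).

(* Comparing [u] with the positive supersolution [w]: by AM-GM,
   [(a - b)^2 >= a^2 (1 - s / t) + b^2 (1 - t / s)]. *)
Lemma dirichlet_lower u C : u v = 0 -> (forall x, w x <= C) ->
  \sum_x u x ^+ 2 <= C * dirichlet u.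
Proof.
move=> uv wC; have wpos x : x != v -> 0 < w x.
  move=> xv; rewrite wE// ltr_pwDl// sumr_ge0// => y _; exact: mulr_ge0.
have C0 : 0 <= C by exact: le_trans (w0 v) (wC v).
pose k x y := p x y * (u x ^+ 2 * (1 - w y / w x)).
have pt x y : k x y + k y x <= p x y * (u x - u y) ^+ 2.
  rewrite /k (sym y x) -mulrDr ler_wpM2l//.
  have [->|xv] := eqVneq x v.
    by rewrite uv wv expr0n /= !mul0r add0r sub0r sqrrN subr0 mulr1.
  have [->|yv] := eqVneq y v.
    by rewrite uv wv expr0n /= !mul0r addr0 !subr0 mulr1.
  (* The difference of the two sides is [p x y] times this square divided by [w x * w y]. *)
  have := sqr_ge0 (u x * w y - u y * w x).
  have wx := wpos _ xv; have wy := wpos _ yv.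
  rewrite -(pmulr_rge0 _ (divr_gt0 (@ltr01 R) (mulr_gt0 wx wy))) -subr_ge0.
  move=> h; rewrite -[leRHS]subr0; apply: le_trans h _; rewrite le_eqVlt.
  by apply/orP; left; apply/eqP; field; rewrite !gt_eqF.
(* The hitting equation enters here: [1 - (w x - 1) / w x = 1 / w x], which is at least [1 / C]. *)
have kE x : x != v -> \sum_y k x y = u x ^+ 2 / w x.
  move=> xv; rewrite /k; under eq_bigr do rewrite mulrCA mulrBr mulr1 mulrA.
  rewrite -mulr_sumr sumrB p1 -mulr_suml -/(kapp p w x); congr (_ * _).
  have -> : kapp p w x = w x - 1 by rewrite (wE x xv) addrAC subrr add0r.
  by field; rewrite gt_eqF// wpos.
have le1 : \sum_x \sum_y k x y <= dirichlet u.
  rewrite dirichletE -(ler_pM2l (ltr0n R 2)) mulrA divff ?mul1r ?pnatr_eq0//.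
  rewrite mulr2n mulrDl mul1r {2}exchange_big -big_split /=.
  apply: ler_sum => x _; rewrite -big_split; apply: ler_sum => y _; exact: pt.
apply: le_trans (ler_wpM2l C0 le1); rewrite mulr_sumr; apply: ler_sum => x _.
have [->|xv] := eqVneq x v.
  rewrite uv expr0n big1 ?mulr0// => y _.
  by rewrite /k uv expr0n mul0r mulr0.
rewrite kE// mulrCA -[leLHS]mulr1 ler_wpM2l ?sqr_ge0//.
by rewrite ler_pdivlMr ?wpos// mul1r.
Qed.

(** Off [v] the function [w - P w] is 1. Its total sum is 0 because the counting measure is
    stationary, which forces the value [1 - |V|] at [v]. *)
Lemma green_identity g :
  \sum_x g x * (w x - kapp p w x) = \sum_x g x - #|V|%:R * g v.
Proof.
have t : \sum_x (w x - kapp p w x) = 0.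
  rewrite sumrB [X in _ - X]exchange_big /=.
  by under [X in _ - X]eq_bigr do rewrite -mulr_suml p1' mul1r; rewrite subrr.
have wEv x : x != v -> w x - kapp p w x = 1 by move=> /wE ->; rewrite addrK.
have {}t : w v - kapp p w v = 1 - #|V|%:R.
  move: t; rewrite (bigD1 v)//=; under eq_bigr => x xv do rewrite wEv//.
  have : \sum_(x : V) 1 = #|V|%:R :> R by rewrite sumr_const.
  rewrite (bigD1 v)//= => <- /eqP; rewrite addr_eq0 => /eqP ->; ring.
rewrite (bigD1 v)//= t [in RHS](bigD1 v)//=.
under eq_bigr => x xv do rewrite wEv// mulr1.
ring.
Qed.

Lemma dirichlet_hitting : dirichlet w = \sum_x w x.
Proof. by rewrite /dirichlet green_identity wv mulr0 subr0. Qed.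

End Target.

(* The commute time is bounded by applying the Dirichlet form to [w + w']. *)
Lemma hitting_le_mean v v' w w' :
  (forall x, x != v -> w x = 1 + kapp p w x) -> w v = 0 ->
  (forall x, x != v' -> w' x = 1 + kapp p w' x) -> w' v' = 0 ->
  #|V|%:R * (w v' + w' v) <= 2 * (\sum_x w x + \sum_x w' x).
Proof.
move=> wE wv wE' wv'; have := dirichlet_ge0 (fun x => w x + w' x).
rewrite /dirichlet; under eq_bigr do rewrite kappD opprD addrACA mulrDr.
rewrite big_split /= (green_identity v w)// (green_identity v' w')// wv wv'.
rewrite !big_split /=; lra.
Qed.

End Dirichlet.

(** Jensen's inequality at each point, then stationarity of [mu]. *)
Lemma wdot_contract (R : realType) (T : finType) (p : T -> T -> R) (mu : T -> R)
    (F : T -> R) :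
  stochastic p -> (forall x, 0 <= mu x) ->
  (forall x y, mu x * p x y = mu y * p y x) ->
  wdot mu (kapp p F) (kapp p F) <= wdot mu F F.
Proof.
move=> [p0 p1] mu0 rev.
have le1 x : kapp p F x ^+ 2 <= kapp p (fun y => F y ^+ 2) x.
  have : 0 <= \sum_y p x y * (F y - kapp p F x) ^+ 2.
    by apply: sumr_ge0 => y _; rewrite mulr_ge0// sqr_ge0.
  have e c : \sum_y p x y * (F y - c) ^+ 2 =
      \sum_y p x y * F y ^+ 2 - 2 * c * (\sum_y p x y * F y) + c ^+ 2 * \sum_y p x y.
    by rewrite !mulr_sumr -sumrB -big_split; apply: eq_bigr => y _ /=; ring.
  rewrite e p1 -/(kapp p F x) -/(kapp p (fun y => F y ^+ 2) x); lra.
have -> : wdot mu F F = wdot mu (fun=> 1) (kapp p (fun y => F y ^+ 2)).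
  rewrite wdot_kapp// (eq_wdot _ (kapp p (fun=> 1)) (fun=> 1) _ (fun y => F y ^+ 2))//.
    by apply: eq_bigr => x _; rewrite mulr1 -mulrA expr2.
  by move=> x; rewrite kapp_const.
by apply: ler_sum => x _; rewrite mulr1 -mulrA -expr2 ler_wpM2l.
Qed.

(** * Lamp updates *)

Section SiteKernel.
Context {R : realType} {V W : finType}.
Implicit Types (K L : W -> W -> R) (f g h : {ffun V -> W}) (F G : {ffun V -> W} -> R).

Definition upd f v b : {ffun V -> W} := [ffun z => if z == v then b else f z].

Lemma updE f v b z : upd f v b z = if z == v then b else f z.
Proof. by rewrite ffunE. Qed.

Lemma upd_upd f v b c : upd (upd f v b) v c = upd f v c.
Proof. by apply/ffunP => z; rewrite !updE; case: eqP. Qed.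

Lemma updC f v v' b c : v != v' -> upd (upd f v b) v' c = upd (upd f v' c) v b.
Proof.
by move=> vv; apply/ffunP => z; rewrite !updE; case: eqVneq => // ->;
  rewrite eq_sym (negPf vv).
Qed.

Definition off v f g := [forall z, (z != v) ==> (g z == f z)].

Lemma offP v f g : reflect (exists b, g = upd f v b) (off v f g).
Proof.
apply: (iffP forallP) => [h|[b -> z]]; last first.
  by rewrite updE; case: eqP => //= _; rewrite eqxx.
exists (g v); apply/ffunP => z; rewrite updE; case: eqVneq => [->//|zv].
by have := h z; rewrite zv => /eqP.
Qed.

Lemma off_sym v f g : off v f g = off v g f.
Proof. by apply: eq_forallb => z; rewrite [g z == _]eq_sym. Qed.

Definition skern K v f g : R := K (f v) (g v) * (off v f g)%:R.

Lemma skernE K v F f : kapp (skern K v) F f = \sum_b K (f v) b * F (upd f v b).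
Proof.
rewrite /kapp (bigID (off v f)) /= [X in _ + X]big1 ?addr0; last first.
  by move=> g /negPf ng; rewrite /skern ng mulr0 mul0r.
rewrite (reindex_onto (upd f v) (fun g => g v)) /=; last first.
  by move=> g /offP[b ->]; rewrite updE eqxx.
rewrite (eq_bigl predT) => [|b].
  apply: eq_bigr => b _; rewrite /skern updE eqxx.
  by rewrite (introT (offP v f _)) ?mulr1//; exists b.
by rewrite updE !eqxx andbT; apply/offP; exists b.
Qed.

Lemma skern_stochastic K v : stochastic K -> stochastic (skern K v).
Proof.
move=> [K0 K1]; split=> [f g|f]; first by rewrite mulr_ge0.
have := skernE K v (fun=> 1) f; rewrite /kapp.
under eq_bigr do rewrite mulr1; move=> ->.
by under eq_bigr do rewrite mulr1.
Qed.

Lemma skern_comm K L v v' F f : v != v' ->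
  kapp (skern K v) (kapp (skern L v') F) f = kapp (skern L v') (kapp (skern K v) F) f.
Proof.
move=> vv; rewrite !skernE.
under eq_bigr => b _.
  rewrite skernE updE eq_sym (negPf vv) mulr_sumr.
  under eq_bigr do rewrite updC//.
  over.
rewrite exchange_big; apply: eq_bigr => c _.
rewrite skernE updE (negPf vv) mulr_sumr; apply: eq_bigr => b _.
by rewrite mulrCA.
Qed.

Lemma skern_comp K L v F f :
  kapp (skern K v) (kapp (skern L v) F) f =
  kapp (skern (fun a b => \sum_c K a c * L c b) v) F f.
Proof.
rewrite !skernE; under eq_bigr => b _.
  rewrite skernE updE eqxx mulr_sumr.
  under eq_bigr do rewrite upd_upd.
  over.
rewrite exchange_big; apply: eq_bigr => c _.
by rewrite mulr_suml; apply: eq_bigr => b _; rewrite mulrA.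
Qed.

Lemma eq_skern K L v F f : (forall a b, K a b = L a b) ->
  kapp (skern K v) F f = kapp (skern L v) F f.
Proof. by move=> e; rewrite !skernE; apply: eq_bigr => b _; rewrite e. Qed.

Lemma skern_indep K v (F : {ffun V -> W} -> R) f : stochastic K ->
  (forall g b, F (upd g v b) = F g) -> kapp (skern K v) F f = F f.
Proof.
move=> [_ K1] indep; rewrite skernE; under eq_bigr do rewrite indep.
by rewrite -mulr_suml K1 mul1r.
Qed.

Variable pi : W -> R.

Definition prodmu f : R := \prod_v pi (f v).

Lemma prodmu_upd f v b : pi (f v) * prodmu (upd f v b) = pi b * prodmu f.
Proof.
rewrite /prodmu (bigD1 v)//= [in RHS](bigD1 v)//= updE eqxx mulrCA; congr (_ * (_ * _)).
by apply: eq_bigr => z /negPf zv; rewrite updE zv.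
Qed.

Lemma prodmu_gt0 f : (forall a, 0 < pi a) -> 0 < prodmu f.
Proof. by move=> pi0; apply: prodr_gt0. Qed.

Lemma skern_rev K v : (forall a, 0 < pi a) ->
  (forall a b, pi a * K a b = pi b * K b a) ->
  forall f g, prodmu f * skern K v f g = prodmu g * skern K v g f.
Proof.
move=> pi0 rev f g; rewrite /skern [off v g f]off_sym.
have [/offP[b ->]|_] := boolP (off v f g); last by rewrite !mulr0.
(* Multiplying by [pi (f v)] lets [prodmu_upd] exchange the weights of the old and the new lamp
   without division. *)
rewrite !mulr1 updE eqxx; apply: (mulfI (lt0r_neq0 (pi0 (f v)))).
by rewrite [RHS]mulrA prodmu_upd mulrCA rev; ring.
Qed.

End SiteKernel.

(** Writing the lamp moves as an update at [x] followed by one at [y] treats [y = x] and [y != x]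
    alike. For [y != x] the intermediate configuration is forced to be [upd f x (g x)]. *)
Lemma lamplighterE (R : realType) (V W : finType) (P : V -> V -> R) (Q : W -> W -> R)
    (f g : {ffun V -> W}) x y :
  lamplighter P Q (f, x) (g, y) =
  P x y * \sum_h skern Q x f h * skern Q y h g.
Proof.
rewrite -[\sum_h _]/(kapp (skern Q x) (fun h => skern Q y h g) f) skernE /=.
rewrite -mulrA; congr (_ * _); case: (eqVneq y x) => [->|yx].
  rewrite mulr_suml; apply: eq_bigr => b _; rewrite /skern updE eqxx -mulrA.
  congr (_ * (_ * _)).
    rewrite (bigD1 (g x))//= eqxx mulr1 big1 ?addr0// => c /negPf ->.
    by rewrite mulr0.
  congr (_%:R); congr nat_of_bool; apply/forallP/forallP => h z; have := h z; rewrite updE andbb;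
    by case: (z == x).
rewrite (bigD1 (g x))//= [X in _ + X]big1 ?addr0 => [|b bx].
  rewrite /skern updE (negPf yx) mulrA; congr (_ * _%:R).
  congr nat_of_bool; apply/forallP/forallP => h z; have := h z; rewrite updE.
    by case: (eqVneq z x) => [->|] /=; rewrite ?eqxx ?implybT.
  by case: (eqVneq z x).
rewrite /skern (_ : off y _ g = false) ?mulr0//; apply/negbTE/forallPn; exists x.
by rewrite updE eqxx eq_sym yx /= eq_sym.
Qed.

(** * The quadratic form of the lamplighter operator *)

Section LamplighterForm.
Context {R : realType} {V W : finType}.
Variables (P : V -> V -> R) (Q : W -> W -> R) (pi : W -> R).
Hypotheses (stochP : stochastic P) (symP : forall x y, P x y = P y x)
  (stochQ : stochastic Q) (pi_gt0 : forall a, 0 < pi a)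
  (revQ : forall a b, pi a * Q a b = pi b * Q b a).
Implicit Types F G : {ffun V -> W} * V -> R.

(** As [P] is symmetric the walker has uniform weight, which is omitted; this is the stationary
    measure up to normalisation. *)
Let mu (s : {ffun V -> W} * V) : R := prodmu pi s.1.

Definition lamp_section F x (f : {ffun V -> W}) : R := F (f, x).

Definition lamp_step F (f : {ffun V -> W}) x : R :=
  kapp (skern Q x) (lamp_section F x) f.

Lemma sum_pairE (F : {ffun V -> W} * V -> R) : \sum_s F s = \sum_f \sum_x F (f, x).
Proof. by rewrite pair_bigA /=; apply: eq_bigr => -[]. Qed.

Lemma wdot_pairE F G :
  wdot mu F G = \sum_x wdot (prodmu pi) (lamp_section F x) (lamp_section G x).
Proof. by rewrite /wdot sum_pairE exchange_big. Qed.

Lemma kapp_lamplighter F f x : kapp (lamplighter P Q) F (f, x) =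
  \sum_y P x y * kapp (skern Q x) (kapp (skern Q y) (lamp_section F y)) f.
Proof.
rewrite /kapp sum_pairE exchange_big; apply: eq_bigr => y _.
under eq_bigr do rewrite lamplighterE -mulrA mulr_suml.
rewrite -mulr_sumr exchange_big; congr (_ * _); apply: eq_bigr => h _.
by rewrite mulr_sumr; apply: eq_bigr => g _; rewrite -mulrA.
Qed.

Lemma lamplighter_stochastic : stochastic (lamplighter P Q).
Proof.
have s0 v f g : 0 <= skern Q v f g by case: (skern_stochastic Q v stochQ).
case: (stochP) => P0 P1; split=> [[f x] [g y]|[f x]].
  by rewrite lamplighterE mulr_ge0// sumr_ge0// => h _; rewrite mulr_ge0.
have := kapp_lamplighter (fun=> 1) f x; rewrite {1}/kapp.
under eq_bigr do rewrite mulr1; move=> ->; rewrite -[RHS](P1 x); apply: eq_bigr => y _.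
rewrite !skern_indep ?mulr1// => g b.
by rewrite !(skern_indep Q y (fun=> 1)).
Qed.

Lemma lamplighter_rev s s' :
  mu s * lamplighter P Q s s' = mu s' * lamplighter P Q s' s.
Proof.
case: s s' => f x [g y]; rewrite !lamplighterE /mu /= [P y x]symP.
rewrite mulrCA [RHS]mulrCA; congr (_ * _); rewrite !mulr_sumr; apply: eq_bigr => h _.
by rewrite mulrA (skern_rev pi)// mulrAC (skern_rev pi Q y)//; ring.
Qed.

(** Self-adjointness moves the update at [x] onto the left factor, leaving
    [\sum_x \sum_y P x y <F~_x, F~_y>] with [F~] given by [lamp_step]. *)
Lemma lamplighter_form F : wdot mu F (kapp (lamplighter P Q) F) =
  \sum_f prodmu pi f *
    (\sum_x lamp_step F f x ^+ 2 - dirichlet P (lamp_step F f)).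
Proof.
transitivity (\sum_x \sum_y P x y *
    wdot (prodmu pi) (fun f => lamp_step F f x) (fun f => lamp_step F f y)).
  rewrite wdot_pairE; apply: eq_bigr => x _.
  transitivity (\sum_y P x y * wdot (prodmu pi) (lamp_section F x)
      (kapp (skern Q x) (fun f => lamp_step F f y))).
    rewrite /wdot; under [RHS]eq_bigr do rewrite mulr_sumr.
    rewrite exchange_big; apply: eq_bigr => f _.
    rewrite {2}/lamp_section kapp_lamplighter mulr_sumr; apply: eq_bigr => y _.
    by rewrite mulrCA.
  apply: eq_bigr => y _; congr (_ * _); rewrite wdot_kapp//.
  exact: skern_rev.
rewrite /wdot; under eq_bigr do under eq_bigr do rewrite mulr_sumr.
under eq_bigr do rewrite exchange_big.
rewrite exchange_big; apply: eq_bigr => f _; set u := lamp_step F f.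
have -> : \sum_x u x ^+ 2 - dirichlet P u = \sum_x u x * kapp P u x.
  by rewrite -sumrB; apply: eq_bigr => x _; ring.
rewrite mulr_sumr; apply: eq_bigr => x _; rewrite /kapp 2![in RHS]mulr_sumr.
by apply: eq_bigr => y _; rewrite /u; ring.
Qed.

Lemma wdot_lamp_step_le F x :
  wdot (prodmu pi) (fun f => lamp_step F f x) (fun f => lamp_step F f x) <=
  wdot (prodmu pi) (lamp_section F x) (lamp_section F x).
Proof.
apply: wdot_contract; first exact: skern_stochastic.
  by move=> f; rewrite ltW// prodmu_gt0.
exact: skern_rev.
Qed.

Lemma lamp_step_norm F : \sum_f prodmu pi f * \sum_x lamp_step F f x ^+ 2 =
  \sum_x wdot (prodmu pi) (fun f => lamp_step F f x) (fun f => lamp_step F f x).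
Proof.
rewrite /wdot; under eq_bigr do rewrite mulr_sumr.
rewrite exchange_big; apply: eq_bigr => x _; apply: eq_bigr => f _.
by rewrite expr2 mulrA.
Qed.

Hypothesis lazy : forall x, 2^-1 <= P x x.

(** The sum of [P x y * (u x + u y)^2] equals [4 |u|^2] minus twice the Dirichlet form, while its
    diagonal terms alone contribute at least [2 |u|^2]. *)
Lemma dirichlet_le_lazy u : dirichlet P u <= \sum_x u x ^+ 2.
Proof.
have : \sum_x 2 * u x ^+ 2 <= \sum_x \sum_y P x y * (u x + u y) ^+ 2.
  apply: ler_sum => x _; rewrite (bigD1 x)//=.
  rewrite ler_wpDr//.
    by apply: sumr_ge0 => y _; rewrite mulr_ge0 ?sqr_ge0//; case: stochP.
  rewrite (_ : (u x + u x) ^+ 2 = 4 * u x ^+ 2); last ring.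
  by rewrite mulrA ler_wpM2r ?sqr_ge0//; have := lazy x; lra.
have -> : \sum_x \sum_y P x y * (u x + u y) ^+ 2 =
    4 * \sum_x u x ^+ 2 - 2 * dirichlet P u.
  have [_ P1] := stochP.
  have -> : 4 * \sum_x u x ^+ 2 = 2 * (\sum_x \sum_y P x y * u x ^+ 2 +
      \sum_x \sum_y P x y * u y ^+ 2).
    have -> : \sum_x \sum_y P x y * u x ^+ 2 = \sum_x u x ^+ 2.
      by apply: eq_bigr => x _; rewrite -mulr_suml P1 mul1r.
    rewrite exchange_big (_ : \sum_y \sum_x _ = \sum_x u x ^+ 2); first by ring.
    apply: eq_bigr => y _; under eq_bigr do rewrite symP.
    by rewrite -mulr_suml P1 mul1r.
  rewrite dirichletE// mulrA divff ?pnatr_eq0// mul1r -big_split mulr_sumr -sumrB.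
  apply: eq_bigr => x _ /=; rewrite -big_split mulr_sumr -sumrB.
  by apply: eq_bigr => y _ /=; ring.
rewrite -mulr_sumr; lra.
Qed.

Lemma lamplighter_form_ge0 F : 0 <= wdot mu F (kapp (lamplighter P Q) F).
Proof.
rewrite lamplighter_form; apply: sumr_ge0 => f _.
by rewrite mulr_ge0 ?subr_ge0 ?dirichlet_le_lazy// ltW// prodmu_gt0.
Qed.

End LamplighterForm.

(** * Upper bound on the lamplighter relaxation time *)

Section LamplighterGap.
Context {R : realType} {V W : finType}.
Variables (P : V -> V -> R) (Q : W -> W -> R) (pi : W -> R).
Hypotheses (stochP : stochastic P) (symP : forall x y, P x y = P y x)
  (stochQ : stochastic Q) (pi_gt0 : forall a, 0 < pi a) (pi1 : \sum_a pi a = 1)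
  (revQ : forall a b, pi a * Q a b = pi b * Q b a)
  (gapQ : forall a f, 1 <= `|a| -> (forall x, kapp Q f x = a * f x) -> constant_fun f).
Implicit Types F : {ffun V -> W} * V -> R.

Let mu (s : {ffun V -> W} * V) : R := prodmu pi s.1.
Let l := `|lambda2 Q|.

(** Applied at a site, this kernel is the conditional expectation given all other lamps. *)
Let resample (a b : W) : R := pi b.

Let resample_stoch : stochastic resample.
Proof. by split=> // a b; exact: ltW. Qed.

Let piQ b : \sum_a pi a * Q a b = pi b.
Proof. by under eq_bigr do rewrite revQ; rewrite -mulr_sumr; case: stochQ => _ ->; rewrite mulr1. Qed.

Lemma sum_resample v (G : {ffun V -> W} -> R) :
  \sum_f prodmu pi f * G f =
  \sum_f prodmu pi f * \sum_b pi b * G (upd f v b).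
Proof.
have := wdot_kapp (skern resample v) (prodmu pi) (fun=> 1) G.
rewrite /wdot => h; transitivity (\sum_f prodmu pi f * 1 * kapp (skern resample v) G f).
  rewrite h; last by apply: skern_rev => // a b; rewrite /resample mulrC.
  by apply: eq_bigr => f _; rewrite skern_indep ?mulr1.
by apply: eq_bigr => f _; rewrite mulr1 skernE.
Qed.

(** With the lamps off [v] frozen, [G] becomes a mean-zero function of one lamp, on which [Q]
    contracts by [l]. *)
Lemma skern_norm_le v (G : {ffun V -> W} -> R) :
  (forall f, kapp (skern resample v) G f = 0) ->
  wdot (prodmu pi) (kapp (skern Q v) G) (kapp (skern Q v) G) <=
  l ^+ 2 * wdot (prodmu pi) G G.
Proof.
move=> G0; rewrite !wdotxx (sum_resample v (fun f => kapp _ _ f ^+ 2)).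
rewrite (sum_resample v (fun f => G f ^+ 2)).
rewrite mulr_sumr; apply: ler_sum => f _; rewrite mulrCA.
apply: ler_wpM2l; first by rewrite ltW ?prodmu_gt0.
pose phi b := G (upd f v b).
have phi0 : wdot pi phi (fun=> 1) = 0.
  by have := G0 f; rewrite skernE => <-; apply: eq_bigr => b _; rewrite mulr1.
have [_ Q1] := stochQ.
have := norm_kapp_le Q pi pi_gt0 revQ Q1 gapQ phi phi0.
rewrite !wdotxx /l real_normK ?num_real//; apply: le_trans.
rewrite le_eqVlt; apply/orP; left; apply/eqP.
apply: eq_bigr => b _; rewrite skernE updE eqxx.
by congr (_ * _ ^+ 2); apply: eq_bigr => c _; rewrite upd_upd.
Qed.

Variable C : R.
Hypothesis wC : forall v, exists w : V -> R,
  [/\ w v = 0, forall x, x != v -> w x = 1 + kapp P w x, forall x, 0 <= w x &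
      forall x, w x <= C].

Let l1 : l < 1.
Proof. by case: stochQ => _ Q1; exact: (lambda2_lt1 Q pi). Qed.

(** Split [u] into [u - u v], which vanishes at [v], and the constant [u v], and use
    [(a + b)^2 <= 2 a^2 + 2 b^2]. *)
Lemma dirichlet_shift u v : \sum_x u x ^+ 2 <= 2 * C * dirichlet P u + 2 * #|V|%:R * u v ^+ 2.
Proof.
have [w [wv wE w0 wle]] := wC v.
have := dirichlet_lower P stochP symP v w wv wE w0 (fun x => u x - u v) C (subrr _) wle.
rewrite dirichletB// => h; rewrite -mulrA; apply: le_trans (lerD (ler_wpM2l (ler0n _ 2) h) (lexx _)).
have -> : 2 * #|V|%:R * u v ^+ 2 = \sum_(x : V) 2 * u v ^+ 2.
  by rewrite sumr_const -mulr_natl; ring.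
rewrite mulr_sumr -big_split; apply: ler_sum => x _ /=.
rewrite -subr_ge0 (_ : _ - _ = (u x - 2 * u v) ^+ 2); first exact: sqr_ge0.
by ring.
Qed.

Let B := 1 + 2 * C + 2 * (#|V|%:R / (1 - l)).

(** With [N] and [M] summed over sites, the loss [(1 - a) N] is the lamp loss [N - M] plus the
    walker loss [D]. Here [M] is bounded by [2 C D + 2 |V| M v], and the gap of [Q] bounds [M v] by
    the lamp loss over [1 - l]. *)
Lemma mean0_eigenvalue_bound v a F s :
  (forall x f, kapp (skern resample v) (lamp_section F x) f = 0) ->
  (forall s, kapp (lamplighter P Q) F s = a * F s) -> F s != 0 ->
  1 <= B * (1 - a).
Proof.
move=> E0 eF Fs; have mu0 s' : 0 < mu s' by exact: prodmu_gt0.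
have Npos := wdot_gt0 mu F s mu0 Fs.
pose N x := wdot (prodmu pi) (lamp_section F x) (lamp_section F x).
pose M x := wdot (prodmu pi) (fun f => lamp_step Q F f x) (fun f => lamp_step Q F f x).
pose D := \sum_f prodmu pi f * dirichlet P (lamp_step Q F f).
have NE : wdot mu F F = \sum_x N x by rewrite /mu wdot_pairE.
have ME : \sum_f prodmu pi f * \sum_x lamp_step Q F f x ^+ 2 = \sum_x M x.
  exact: lamp_step_norm.
have eq1 : a * \sum_x N x = \sum_x M x - D.
  rewrite -NE -wdotZl wdotC -(eq_wdot mu F F _ _ (fun=> erefl) eF) /mu lamplighter_form//.
  by rewrite -ME -sumrB; apply: eq_bigr => f _; rewrite mulrBr.
have le2 : \sum_x M x <= 2 * C * D + 2 * #|V|%:R * M v.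
  rewrite -ME /D /M /wdot !mulr_sumr -big_split; apply: ler_sum => f _ /=.
  have := dirichlet_shift (lamp_step Q F f) v.
  move=> /(ler_wpM2l (ltW (prodmu_gt0 pi f pi_gt0))) h; apply: le_trans h _.
  rewrite le_eqVlt; apply/orP; left; apply/eqP; ring.
have le3 : M v <= l ^+ 2 * N v by apply: skern_norm_le; exact: E0.
have le4 : N v - M v <= \sum_x N x - \sum_x M x.
  rewrite -[leRHS]sumrB [leRHS](bigD1 v)//= lerDl sumr_ge0// => x _.
  by rewrite subr_ge0; exact: wdot_lamp_step_le.
have D0 : 0 <= D.
  apply: sumr_ge0 => f _; rewrite mulr_ge0 ?dirichlet_ge0// ltW// prodmu_gt0//.
have M0 : 0 <= N v by apply: wdot_ge0 => f; exact: prodmu_gt0.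
have C0 : 0 <= C by have [w [_ _ w0 wle]] := wC v; exact: le_trans (w0 v) (wle v).
have l0 : 0 <= l by exact: normr_ge0.
have le5 : M v * (1 - l) <= \sum_x N x - \sum_x M x.
  apply: le_trans le4; move: le3 M0 l0 l1; move: (M v) (N v) (l) => m n k h n0 k0 k1.
  (* The factor is [1 - (2 - k) k^2]; with [m <= k^2 n] this yields [(2 - k) m <= n], that is,
     [m (1 - k) <= n - m]. *)
  have h1 : 0 <= n * ((1 - k) * (1 + k * (1 - k))).
    have k2 : 0 <= 1 - k by lra.
    have k3 : 0 <= k * (1 - k) by exact: mulr_ge0.
    by apply: mulr_ge0 => //; apply: mulr_ge0 => //; lra.
  have h2 : 0 <= (2 - k) * (k ^+ 2 * n - m) by apply: mulr_ge0; lra.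
  lra.
have le6 : M v <= (\sum_x N x - \sum_x M x) / (1 - l).
  by rewrite ler_pdivlMr// subr_gt0.
rewrite NE in Npos; rewrite -(ler_pM2r Npos) mul1r -mulrA mulrBl mul1r eq1.
move: le2 le6 le5 Npos; rewrite /B.
set Ns := \sum_x N x; set Ms := \sum_x M x => le2 le6 le5 Npos.
have li : 0 < (1 - l)^-1 by rewrite invr_gt0 subr_gt0.
have n0 : 0 <= #|V|%:R :> R by rewrite ler0n.
have d0 : 0 <= Ns - Ms.
  by rewrite /Ns /Ms -sumrB sumr_ge0// => x _; rewrite subr_ge0; exact: wdot_lamp_step_le.
have h7 : #|V|%:R * M v <= #|V|%:R / (1 - l) * (Ns - Ms).
  by rewrite -mulrA ler_wpM2l// mulrC.
have h8 : 0 <= C * (Ns - Ms) by rewrite mulr_ge0.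
have h9 : 0 <= #|V|%:R / (1 - l) * D by rewrite mulr_ge0// mulr_ge0// ltW.
move: h7 h9; set c := _ / (1 - l); nra.
Qed.

(** At distinct sites the updates commute; at the same site both orders reduce to resampling, since
    [pi] is stationary for [Q]. *)
Let resampleC v x (G : {ffun V -> W} -> R) f :
  kapp (skern Q x) (kapp (skern resample v) G) f =
  kapp (skern resample v) (kapp (skern Q x) G) f.
Proof.
have [->|xv] := eqVneq x v; last exact: skern_comm.
rewrite !skern_comp; apply: eq_skern => a b; rewrite /resample piQ -mulr_suml.
by case: stochQ => _ ->; rewrite mul1r.
Qed.

Let centered v F (s : {ffun V -> W} * V) : R :=
  F s - kapp (skern resample v) (lamp_section F s.2) s.1.

Let kappB (T : finType) (p : T -> T -> R) f g x :
  kapp p (fun y => f y - g y) x = kapp p f x - kapp p g x.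
Proof. by rewrite /kapp -sumrB; apply: eq_bigr => y _; rewrite mulrBr. Qed.

Lemma centered_eigen v a F :
  (forall s, kapp (lamplighter P Q) F s = a * F s) ->
  forall s, kapp (lamplighter P Q) (centered v F) s = a * centered v F s.
Proof.
move=> eF [f x]; rewrite kappB eF /centered mulrBr; congr (_ - _) => /=.
rewrite kapp_lamplighter.
transitivity (kapp (skern resample v)
    (fun g => kapp (lamplighter P Q) F (g, x)) f); last first.
  rewrite -kappZ; apply: eq_kapp => g; exact: eF.
under [RHS]eq_kapp => g do rewrite kapp_lamplighter.
rewrite {2}/kapp; under [RHS]eq_bigr do rewrite mulr_sumr.
rewrite [RHS]exchange_big; apply: eq_bigr => y _ /=.
under [RHS]eq_bigr do rewrite mulrCA.
rewrite -mulr_sumr; congr (_ * _).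
transitivity (kapp (skern Q x) (kapp (skern resample v)
    (kapp (skern Q y) (lamp_section F y))) f); last exact: resampleC.
by apply: eq_kapp => g; rewrite -resampleC.
Qed.

Lemma centered_mean0 v F x f :
  kapp (skern resample v) (lamp_section (centered v F) x) f = 0.
Proof.
rewrite kappB; apply/eqP; rewrite subr_eq0; apply/eqP; symmetry.
rewrite -[LHS]/(kapp (skern resample v) (kapp (skern resample v) (lamp_section F x)) f).
rewrite skern_comp.
apply: eq_skern => c b; rewrite /resample.
by rewrite -mulr_suml pi1 mul1r.
Qed.

(** The previous bound kills every centred part of [F], so [F] ignores the lamps and is an
    eigenfunction of [P], to which the Poincaré inequality with constant [C] applies. *)
Lemma lamplighter_gap a F : B * (1 - a) < 1 ->
  (forall s, kapp (lamplighter P Q) F s = a * F s) -> constant_fun F.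
Proof.
move=> Ba eF.
have c0 v s : centered v F s = 0.
  apply/eqP/negPn/negP => cs; move: Ba; rewrite ltNge => /negP; apply.
  apply: (mean0_eigenvalue_bound v a (centered v F) s) => //.
    by move=> x f; exact: centered_mean0.
  exact: centered_eigen.
have indep v f b x : F (upd f v b, x) = F (f, x).
  have e g : F (g, x) = kapp (skern resample v) (lamp_section F x) g.
    by apply/eqP; rewrite -subr_eq0 -[_ - _]/(centered v F (g, x)) c0.
  by rewrite !e !skernE; apply: eq_bigr => c _; rewrite upd_upd.
have Ffg f g x : F (f, x) = F (g, x).
  (* The lamps are changed from [f] to [g] one site at a time. *)
  have h (r : seq V) : F ([ffun z => if z \in r then g z else f z], x) = F (f, x).
    elim: r => [|v r IH]; first by congr (F (_, x)); apply/ffunP => z; rewrite ffunE.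
    rewrite -[RHS]IH -[RHS](indep v _ (g v)); congr (F (_, x)); apply/ffunP => z.
    by rewrite updE !ffunE inE; case: eqVneq => [->|].
  rewrite -(h (enum V)); congr (F (_, x)); apply/ffunP => z.
  by rewrite ffunE mem_enum.
move=> [f x0] [g y0]; rewrite (Ffg g f); pose h x := F (f, x).
suff : constant_fun h by apply.
have eh x : kapp P h x = a * h x.
  rewrite -[a * _]/(a * F (f, x)) -eF kapp_lamplighter; apply: eq_bigr => y _.
  rewrite !skern_indep => // k b; first exact: indep.
  by rewrite !skern_indep// => *; exact: indep.
have [w [_ _ w0 wle]] := wC x0.
have C0 : 0 <= C by exact: le_trans (w0 x0) (wle x0).
have dh : dirichlet P h = (1 - a) * \sum_x h x ^+ 2.
  by rewrite mulr_sumr; apply: eq_bigr => x _; rewrite eh; ring.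
have key : \sum_x (h x - h x0) ^+ 2 <= C * dirichlet P h.
  have [w' [wv wE w0' wle']] := wC x0; rewrite -(dirichletB P stochP symP h (h x0)).
  by apply: (dirichlet_lower P stochP symP x0 w') => //; rewrite subrr.
have sq0 (u : V -> R) : \sum_x u x ^+ 2 <= 0 -> forall x, u x = 0.
  move=> u0 x; have : \sum_x u x ^+ 2 == 0.
    by rewrite eq_le u0 sumr_ge0// => y _; rewrite sqr_ge0.
  rewrite psumr_eq0 => [/allP/(_ x (mem_index_enum _))/=|y _]; last exact: sqr_ge0.
  by rewrite sqrf_eq0 => /eqP.
have [a1|a1] := eqVneq a 1.
  have hx x : h x = h x0.
    apply/eqP; rewrite -subr_eq0; apply/eqP; apply: (sq0 (fun x => h x - h x0)).
    by apply: le_trans key _; rewrite dh a1 subrr mul0r mulr0.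
  by move=> x y; rewrite !hx.
have Sh : \sum_x h x = 0.
  have [_ P1] := stochP.
  have := eigenfun_mean0 P (fun=> 1) _ P1 a h eh a1.
  rewrite /wdot; under eq_bigr do rewrite mul1r mulr1.
  by apply => x y; rewrite !mul1r.
(* As [h] has mean zero, subtracting the constant [h x0] can only increase its norm. *)
have key2 : \sum_x h x ^+ 2 <= C * ((1 - a) * \sum_x h x ^+ 2).
  rewrite -dh; apply: le_trans key.
  rewrite (_ : \sum_x (h x - h x0) ^+ 2 =
    \sum_x h x ^+ 2 - 2 * h x0 * \sum_x h x + \sum_(x : V) h x0 ^+ 2).
    by rewrite Sh mulr0 subr0 lerDl sumr_ge0// => x _; exact: sqr_ge0.
  rewrite mulr_sumr -sumrB -big_split; apply: eq_bigr => x _ /=; ring.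
have [S0|S0] := lerP (\sum_x h x ^+ 2) 0.
  by move=> x y; rewrite !(sq0 h).
exfalso; move: key2; rewrite mulrA -{1}[\sum_x _]mul1r ler_pM2r// => key2.
have a1' : 0 < 1 - a.
  by rewrite ltNge; apply/negP => a2; have := mulr_ge0_le0 C0 a2; lra.
move: Ba; rewrite ltNge => /negP; apply; apply: le_trans key2 _.
rewrite ler_pM2r// /B.
have : 0 <= #|V|%:R / (1 - l) :> R by rewrite divr_ge0// subr_ge0 ltW.
lra.
Qed.

Hypothesis lazyP : forall x, P x x = 2^-1.
Let D := C + #|V|%:R / (1 - l).

Let mu_gt0 s : 0 < mu s. Proof. exact: prodmu_gt0. Qed.

Let mu_rev s s' : mu s * lamplighter P Q s s' = mu s' * lamplighter P Q s' s.
Proof. exact: lamplighter_rev. Qed.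

Let l0 : 0 <= l. Proof. exact: normr_ge0. Qed.

Lemma hit_plus_gap_ge1 (v : V) : 1 <= D.
Proof.
have [w [_ _ w0 wle]] := wC v.
have C0 : 0 <= C by exact: le_trans (w0 v) (wle v).
rewrite /D -[leLHS]add0r lerD// ler_pdivlMr ?subr_gt0// mul1r.
apply: (@le_trans _ _ 1); first by rewrite gerBl.
by rewrite ler1n; apply/card_gt0P; exists v.
Qed.

Lemma lamplighter_eigenfun_constant (v : V) a F : 1 - (3 * D)^-1 < `|a| ->
  (forall s, kapp (lamplighter P Q) F s = a * F s) -> constant_fun F.
Proof.
move=> ra eF; have D1 := hit_plus_gap_ge1 v.
have [a0|a0] := ltP a 0.
  have FF0 : wdot mu F F <= 0.
    have := lamplighter_form_ge0 P Q pi stochP symP pi_gt0 revQ _ F.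
    rewrite -/mu => h; have {h} : 0 <= a * wdot mu F F.
      rewrite -wdotZl wdotC -(eq_wdot mu F F _ _ (fun=> erefl) eF); apply: h => x.
      by rewrite lazyP.
    by rewrite nmulr_rge0.
  have F0 s : F s = 0.
    apply/eqP/negPn/negP => Fs.
    by have := wdot_gt0 mu F s mu_gt0 Fs; rewrite ltNge FF0.
  by move=> s s'; rewrite !F0.
apply: (lamplighter_gap a) => //.
(* Indeed [B = 1 + 2 * D] and [1 <= D]. *)
have BD : B <= 3 * D.
  move: D1; rewrite /B /D; have [w [_ _ w0 wle]] := wC v.
  have C0 : 0 <= C by exact: le_trans (w0 v) (wle v).
  lra.
have B0 : 0 <= B.
  have [w [_ _ w0 wle]] := wC v.
  have C0 : 0 <= C by exact: le_trans (w0 v) (wle v).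
  have : 0 <= #|V|%:R / (1 - l) :> R by rewrite divr_ge0// subr_ge0 ltW.
  rewrite /B; lra.
have D3 : 0 < 3 * D by lra.
rewrite ger0_norm// in ra.
have [a1|a1] := lerP (1 - a) 0; first by have := mulr_ge0_le0 B0 a1; lra.
apply: (@le_lt_trans _ _ (3 * D * (1 - a))); first by rewrite ler_pM2r.
by rewrite -ltr_pdivlMl// mulr1; lra.
Qed.

Lemma lamplighter_lambda2_le (v : V) :
  `|lambda2 (lamplighter P Q)| <= 1 - (3 * D)^-1.
Proof.
apply: (lambda2_le _ mu mu_gt0 mu_rev).
  rewrite subr_ge0 invf_le1; have := hit_plus_gap_ge1 v; lra.
exact: lamplighter_eigenfun_constant v.
Qed.

(** * Lower bounds from test functions *)

Hypothesis W1 : (1 < #|W|)%N.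

Definition scale_at v (u : V -> R) x : R := if x == v then lambda2 Q * u x else u x.

(* The test function is [phi (f v) * u x], with [phi] an eigenfunction of the lamp
   chain; a lamp update at [v] multiplies it by [lambda2 Q]. *)
Lemma lamplighter_rayleigh v (u : V -> R) :
  \sum_x scale_at v u x ^+ 2 - dirichlet P (scale_at v u) <=
  `|lambda2 (lamplighter P Q)| * \sum_x u x ^+ 2.
Proof.
set u' := scale_at v u; have [_ Q1] := stochQ.
have [phi [a0 [phia phi0 ephi]]] := lambda2_eigenfun Q pi pi_gt0 revQ Q1 gapQ W1.
pose F (s : {ffun V -> W} * V) := phi (s.1 v) * u s.2.
have stepE f x : lamp_step Q F f x = phi (f v) * u' x.
  rewrite /lamp_step skernE /lamp_section /F /= /u' /scale_at; have [->|xv] := eqVneq x v.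
    under eq_bigr do rewrite updE eqxx mulrA.
    by rewrite -mulr_suml -/(kapp Q phi (f v)) ephi; ring.
  under eq_bigr do rewrite updE eq_sym (negPf xv).
  by rewrite -mulr_suml Q1 mul1r.
pose Z := \sum_f prodmu pi f * phi (f v) ^+ 2.
have Z0 : 0 < Z.
  rewrite /Z -(wdotxx (prodmu pi) (fun f => phi (f v))).
  apply: (wdot_gt0 _ _ [ffun=> a0]); last by rewrite ffunE.
  by move=> f; exact: prodmu_gt0.
have mean0 : wdot mu F (fun=> 1) = 0.
  rewrite wdot_pairE big1// => x _; rewrite /wdot /lamp_section /F /=.
  under eq_bigr do rewrite mulr1 mulrA.
  rewrite -mulr_suml (sum_resample v (fun f => phi (f v))) big1 ?mul0r// => f _.
  under eq_bigr do rewrite updE eqxx.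
  have -> : \sum_b pi b * phi b = 0.
    by rewrite -[RHS]phi0; apply: eq_bigr => b _; rewrite mulr1.
  by rewrite mulr0.
have FF : wdot mu F F = Z * \sum_x u x ^+ 2.
  rewrite wdotxx sum_pairE /Z mulr_suml; apply: eq_bigr => f _.
  by rewrite mulr_sumr; apply: eq_bigr => x _; rewrite /mu /F /=; ring.
have FTF : wdot mu F (kapp (lamplighter P Q) F) =
    Z * (\sum_x u' x ^+ 2 - dirichlet P u').
  rewrite /mu lamplighter_form// /Z mulr_suml; apply: eq_bigr => f _.
  rewrite -mulrA [in RHS]mulrBr; congr (_ * (_ - _)).
    by rewrite mulr_sumr; apply: eq_bigr => x _; rewrite stepE exprMn.
  rewrite /dirichlet mulr_sumr; apply: eq_bigr => x _.
  rewrite stepE (eq_kapp P _ (fun x => phi (f v) * u' x)); last exact: stepE.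
  by rewrite kappZ; ring.
have [_ T1] := lamplighter_stochastic P Q stochP stochQ.
have := rayleigh_le _ mu mu_gt0 mu_rev T1 _ F mean0.
rewrite FF FTF mulrCA (ler_pM2l Z0); apply => a G a1.
apply: (lamplighter_eigenfun_constant v); apply: lt_le_trans a1.
by rewrite gtrBl invr_gt0; have := hit_plus_gap_ge1 v; lra.
Qed.

Let tT := (1 - `|lambda2 (lamplighter P Q)|)^-1.

Let gapT_gt0 (v : V) : 0 < 1 - `|lambda2 (lamplighter P Q)|.
Proof.
rewrite subr_gt0; apply: le_lt_trans (lamplighter_lambda2_le v) _.
by rewrite gtrBl invr_gt0; have := hit_plus_gap_ge1 v; lra.
Qed.

(** The sign [s] makes [lambda2 Q * s = l], so a lamp step turns [u] into 1 with value [l] at [v].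
    The loss is [(1 - l^2) + (1 - l)^2 / 2 = (1 - l) (3 + l) / 2], at most [2 (1 - l)]. *)
Lemma lamplighter_ge_lamp (v : V) : #|V|%:R / (1 - l) <= 2 * tT.
Proof.
pose s : R := if 0 <= lambda2 Q then 1 else -1.
have sl : lambda2 Q * s = l.
  by rewrite /s /l; case: ger0P => _; rewrite ?mulr1// mulrN1.
have s2 : s ^+ 2 = 1 by rewrite /s; case: ifP; rewrite ?sqrrN expr1n.
pose u x := if x == v then s else 1.
have := lamplighter_rayleigh v u.
set u' := scale_at v u; set lT := `|_|.
have uE x : u' x = (l - 1) * (x == v)%:R + 1.
  by rewrite /u' /scale_at /u; case: (x == v); rewrite /= ?sl; ring.
have sum_delta (k : V -> R) : \sum_x k x * (x == v)%:R = k v.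
  rewrite (bigD1 v)//= eqxx mulr1 big1 ?addr0// => x /negPf ->.
  by rewrite mulr0.
have -> : \sum_x u x ^+ 2 = #|V|%:R.
  transitivity (\sum_(x : V) (1 : R)); last by rewrite sumr_const.
  by apply: eq_bigr => x _; rewrite /u; case: ifP; rewrite ?s2 ?expr1n.
have -> : \sum_x u' x ^+ 2 = #|V|%:R - (1 - l ^+ 2).
  transitivity (\sum_(x : V) (1 - (1 - l ^+ 2) * (x == v)%:R)).
    by apply: eq_bigr => x _; rewrite uE; case: (x == v) => /=; ring.
  by rewrite sumrB sumr_const (sum_delta (fun=> _)).
have -> : dirichlet P u' = (1 - l) ^+ 2 / 2.
  rewrite -(dirichletB P stochP symP u' 1) /dirichlet.
  transitivity (\sum_x ((l - 1) ^+ 2 * (1 - P x v)) * (x == v)%:R).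
    apply: eq_bigr => x _; rewrite !uE addrK /kapp.
    under eq_bigr do rewrite uE addrK mulrA.
    by rewrite (sum_delta (fun y => P x y * (l - 1))); case: eqVneq => [->|_] /=; ring.
  by rewrite sum_delta lazyP; field.
move=> h; rewrite ler_pdivrMr ?subr_gt0// mulrAC ler_pdivlMr; last exact: gapT_gt0.
rewrite -/lT; move: h l0 l1; move: (#|V|%:R) (l) lT => n k t; nra.
Qed.

(** As [w v = 0], the lamp step leaves [w] unchanged and the loss is its Dirichlet form, equal to
    [\sum_x w x]. Cauchy-Schwarz then compares this sum with the norm of [w]. *)
Lemma lamplighter_ge_mean_hit v (w : V -> R) : w v = 0 ->
  (forall x, x != v -> w x = 1 + kapp P w x) -> (forall x, 0 <= w x) ->
  \sum_x w x <= #|V|%:R * tT.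
Proof.
move=> wv wE w0; have := lamplighter_rayleigh v w.
set u' := scale_at v w; have u'E x : u' x = w x.
  by rewrite /u' /scale_at; case: eqP => // ->; rewrite wv mulr0.
have -> : \sum_x u' x ^+ 2 = \sum_x w x ^+ 2 by apply: eq_bigr => x _; rewrite u'E.
have -> : dirichlet P u' = \sum_x w x.
  rewrite -(dirichlet_hitting P stochP symP v w)//; apply: eq_bigr => x _.
  by rewrite (eq_kapp _ _ w)// u'E.
set A := \sum_x w x; set S := \sum_x w x ^+ 2; set lT := `|_| => h.
have CS : A ^+ 2 <= #|V|%:R * S.
  have n0 : 0 < #|V|%:R :> R by rewrite ltr0n; apply/card_gt0P; exists v.
  have : 0 <= \sum_x (#|V|%:R * w x - A) ^+ 2 by apply: sumr_ge0 => x _; exact: sqr_ge0.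
  have -> : \sum_x (#|V|%:R * w x - A) ^+ 2 =
      #|V|%:R ^+ 2 * S - 2 * A * #|V|%:R * A + #|V|%:R * A ^+ 2.
    have -> : #|V|%:R * A ^+ 2 = \sum_(x : V) A ^+ 2 by rewrite sumr_const mulr_natl.
    have eA c : c * A = \sum_x c * w x by exact: mulr_sumr.
    have eS c : c * S = \sum_x c * w x ^+ 2 by exact: mulr_sumr.
    rewrite eS (eA (2 * A * _)) -sumrB -big_split.
    by apply: eq_bigr => x _ /=; ring.
  move=> h1; rewrite -(ler_pM2l n0) -subr_ge0; apply: le_trans h1 _.
  rewrite le_eqVlt; apply/orP; left; apply/eqP; ring.
have A0 : 0 <= A by apply: sumr_ge0.
have g0 := gapT_gt0 v; rewrite ler_pdivlMr//.
move: A0; rewrite le_eqVlt => /orP[/eqP <-|A0]; first by rewrite mul0r ler0n.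
rewrite -(ler_pM2l A0) mulrA -expr2.
apply: (@le_trans _ _ (#|V|%:R * S * (1 - lT))); first by rewrite ler_pM2r.
rewrite -mulrA [leRHS]mulrC ler_wpM2l//.
by move: h; lra.
Qed.

End LamplighterGap.

(** * The lazy walk and the two times *)

Section LazyWalk.
Context {R : realType} {V : finType}.
Variable e : rel V.
Hypotheses (simple_e : simple_graph e) (conn_e : connected_graph e)
  (reg_e : regular_graph e) (V1 : (1 < #|V|)%N).

Let P := lazy_walk R e.

Lemma lazy_walk_diag x : P x x = 2^-1.
Proof. by rewrite /P /lazy_walk eqxx. Qed.

Lemma degree_gt0 x : (0 < degree e x)%N.
Proof.
have [y yx] : exists y, y != x.
  have : (0 < #|predC1 x|)%N by have := cardC1 x => ->; rewrite -subn1 subn_gt0.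
  by case/card_gt0P => y; rewrite inE => yx; exists y.
have /connectP[[|z r] /= ] := conn_e x y; first by move=> _ yx'; rewrite yx' eqxx in yx.
by move=> /andP[xz _] _; apply/card_gt0P; exists z; rewrite inE.
Qed.

(** Regularity enters here: equal degrees make the walk symmetric. *)
Lemma lazy_walk_sym x y : P x y = P y x.
Proof.
have [d dE] := reg_e; have [symE _] := simple_e.
by rewrite /P /lazy_walk !dE [y == x]eq_sym symE.
Qed.

Lemma lazy_walk_stochastic : stochastic P.
Proof.
split=> [x y|x]; rewrite /P /lazy_walk.
  by case: ifP => _; [|case: ifP => _]; rewrite ?invr_ge0 ?mulr_ge0.
have [_ irrE] := simple_e.
rewrite (bigD1 x)//= eqxx -[X in _ + X = _](_ : 2^-1 = _); first by field.
transitivity (\sum_(y in [set y | e x y]) (2 * (degree e x)%:R)^-1 : R).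
  rewrite sumr_const -/(degree e x) -mulr_natl; have := degree_gt0 x; rewrite -(ltr0n R).
  by move=> d0; field; rewrite gt_eqF.
rewrite [LHS]big_mkcond [RHS]big_mkcond; apply: eq_bigr => y _ /=.
by rewrite inE; case: eqVneq => [->|_] //=; rewrite irrE.
Qed.

Lemma lazy_walk_irreducible : irreducible_chain P.
Proof.
have s0 := lazy_walk_stochastic; have [P0 _] := s0.
move=> x y; have /connectP[r er ->] := conn_e x y; exists (size r).
elim: r x er => [|z r IH] x /=; first by rewrite eqxx ltr01.
move=> /andP[xz er]; rewrite (bigD1 z)//= ltr_pwDl//; last first.
  by apply: sumr_ge0 => t _; rewrite mulr_ge0// kpow_ge0.
rewrite mulr_gt0 ?IH// /P /lazy_walk xz; case: ifP => _; rewrite invr_gt0//.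
by rewrite mulr_gt0// ltr0n degree_gt0.
Qed.

End LazyWalk.

Lemma thitE (R : realType) (T : finType) (p : T -> T -> R) :
  stochastic p -> irreducible_chain p ->
  exists (w : T -> T -> R) (C : R),
    [/\ forall v, [/\ w v v = 0, forall x, x != v -> w v x = 1 + kapp p (w v) x,
                      forall x, 0 <= w v x & forall x, w v x <= C],
        thit p = C%:E &
        forall K, 0 <= K -> (forall v x, w v x <= K) -> C <= K].
Proof.
move=> sp irr; have [w hw] := choice (fun v => hitting_system p v sp irr).
exists w, (\big[Num.max/0]_(xy : T * T) w xy.2 xy.1); split.
- move=> v; have [wv wE w0] := hw v; split => // x.
  exact: (le_bigmax _ (fun xy : T * T => w xy.2 xy.1) (x, v)).
- rewrite /thit (eq_bigr (fun xy => (w xy.2 xy.1)%:E)) => [|xy _].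
    by rewrite (big_morph EFin (@EFin_max R) erefl).
  by have [wv wE w0] := hw xy.2; exact: expected_hitE.
by move=> K K0 wK; apply: bigmax_le.
Qed.

Lemma trelE (R : realType) (T : finType) (p : T -> T -> R) :
  `|lambda2 p| < 1 -> trel p = ((1 - `|lambda2 p|)^-1)%:E.
Proof. by move=> h; rewrite /trel inver subr_eq0 gt_eqF. Qed.

Theorem theorem1p3 (R : realType) :
  exists c1 C1 : R, [/\ 0 < c1, c1 <= C1 &
    forall (V W : finType) (G : rel V) (H : rel W) (Q : W -> W -> R),
      simple_graph G -> connected_graph G -> regular_graph G ->
      (1 < #|V|)%N ->
      simple_graph H -> connected_graph H ->
      (1 < #|W|)%N ->
      stochastic Q -> irreducible_chain Q -> aperiodic_chain Q ->
      reversible_chain Q ->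
      let P := lazy_walk R G in
      (c1%:E <= trel (lamplighter P Q) / (thit P + #|V|%:R%:E * trel Q)
             <= C1%:E)%E].
Proof.
(* The 6 adds the 4 from the hitting time and the 2 from the lamp term; the 3 is that of
   [B <= 3 * D]. *)
exists 6^-1, 3; split; [by rewrite invr_gt0|lra|].
move=> V W G H Q simG connG regG V1 _ _ W1 stochQ irrQ aperQ [pi [pi0 pi1 revQ]].
cbv zeta; set P := lazy_walk R G.
have pi_gt0 := reversible_gt0 Q stochQ pi irrQ pi0 pi1 revQ.
have gapQ := ergodic_eigenfun_constant Q stochQ irrQ aperQ.
have stochP := lazy_walk_stochastic G simG connG V1 : stochastic P.
have symP := lazy_walk_sym G simG regG : forall x y, P x y = P y x.
have irrP := lazy_walk_irreducible G simG connG V1 : irreducible_chain P.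
have lazyP := lazy_walk_diag G : forall x, P x x = 2^-1.
have [w [C [hw -> hC]]] := thitE R V P stochP irrP.
have wC v : exists w, [/\ w v = 0, forall x, x != v -> w x = 1 + kapp P w x,
    forall x, 0 <= w x & forall x, w x <= C] by exists (w v).
have /card_gt0P[v _] : (0 < #|V|)%N by exact: ltnW.
have Q1 : forall x, \sum_y Q x y = 1 by case: stochQ.
have l1 := lambda2_lt1 Q pi pi_gt0 revQ gapQ.
have D1 : 1 <= C + #|V|%:R / (1 - `|lambda2 Q|).
  exact: (hit_plus_gap_ge1 P Q pi stochQ pi_gt0 revQ gapQ C wC v).
have up : `|lambda2 (lamplighter P Q)| <=
    1 - (3 * (C + #|V|%:R / (1 - `|lambda2 Q|)))^-1.
  exact: (lamplighter_lambda2_le P Q pi stochP symP stochQ pi_gt0 pi1 revQ gapQ C wC lazyP v).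
have lampT : #|V|%:R / (1 - `|lambda2 Q|) <=
    2 * (1 - `|lambda2 (lamplighter P Q)|)^-1.
  exact: (lamplighter_ge_lamp P Q pi stochP symP stochQ pi_gt0 pi1 revQ gapQ C wC lazyP W1 v).
have hitT u : \sum_x w u x <= #|V|%:R * (1 - `|lambda2 (lamplighter P Q)|)^-1.
  have [wu uE u0 _] := hw u.
  exact: (lamplighter_ge_mean_hit P Q pi stochP symP stochQ pi_gt0 pi1 revQ gapQ C wC lazyP W1 u (w u) wu uE u0).
move: D1 up lampT hitT; set lT := `|lambda2 (lamplighter P Q)|.
set n := #|V|%:R; set D := C + _ => D1 up lampT hitT.
have lT1 : lT < 1.
  by apply: le_lt_trans up _; rewrite gtrBl invr_gt0; lra.
rewrite !trelE// -/lT.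
have tT0 : 0 < (1 - lT)^-1 by rewrite invr_gt0 subr_gt0.
have n0 : 0 < n by rewrite ltr0n ltnW.
(* Each hitting time is at most the commute time, bounded by twice the sum of two means, each at
   most [(1 - lT)^-1]. *)
have CT : C <= 4 * (1 - lT)^-1.
  apply: hC => [|u x]; first lra.
  have [wu uE u0 _] := hw u; have [wx xE x0 _] := hw x.
  have := hitting_le_mean P stochP symP u x (w u) (w x) uE wu xE wx.
  have := hitT u; have := hitT x; have := x0 u.
  rewrite -/n -(ler_pM2l n0); have := u0 x; nra.
rewrite -EFinM -EFinD -/D inver gt_eqF ?(lt_le_trans ltr01 D1)// -EFinM !lee_fin.
have D0 : 0 < D by exact: lt_le_trans ltr01 D1.
apply/andP; split; first by rewrite ler_pdivlMr// /D; lra.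
rewrite ler_pdivrMr// -[3 * D]invrK lef_pV2 ?posrE ?subr_gt0 ?invr_gt0 ?mulr_gt0//.
lra.
Qed.
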